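(* For every integer $m\ge1$, all real $A>C>0$, every $D>0$, and all real $p,q\ne0$ with $p^2+q^2<1$, the metric $$g_P=g_{A,C}+\sigma\otimes\sigma+p(\beta_1\otimes\sigma+\sigma\otimes\beta_1)+q(\beta_3\otimes\sigma+\sigma\otimes\beta_3)$$ on $P_m=S^{4m-1}\times S^1_i$ carries a one-dimensional totally geodesic foliation by closed circles with $K_{\mathrm{mix}}>0$, namely the foliation generated by $T=u_1$. The leaves have length $4\pi/\sqrt{AC}$, and the metric is not bundle-like with respect to this foliation.
   Context: $K_{\mathrm{mix}}$ is the sectional curvature of 2-planes spanned by a vector tangent to the foliation and a vector orthogonal to it. A foliation is totally geodesic if its leaves are totally geodesic submanifolds. A metric is bundle-like if locally the foliation is given by the fibers of a Riemannian submersion; for a one-dimensional geodesic foliation with unit tangent field $T$ this is equivalent to $(\mathcal L_Tg)(U,V)=0$ for all $U,V\perp T$. Notation. Let $g_0$ be the round metric of curvature $1$ on the unit sphere $S^{4m-1}\subset\mathbb H^m$, with $\xi_1(x)=xi$, $\xi_2(x)=xj$, $\xi_3(x)=xk$ and $\eta_\alpha=g_0(\xi_\alpha,\cdot)$. Put $L=2/\sqrt{AC}$, $M=2/A$, $g_{A,C}=L^2g_0+(M^2-L^2)\eta_2\otimes\eta_2$. The fields $u_1=\frac{\sqrt{AC}}2\xi_1$, $u_2=\frac A2\xi_2$, $u_3=\frac{\sqrt{AC}}2\xi_3$ are $g_{A,C}$-orthonormal and satisfy $[u_1,u_2]=Au_3$, $[u_2,u_3]=Au_1$, $[u_3,u_1]=Cu_2$;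 put $\beta_\alpha=g_{A,C}(u_\alpha,\cdot)$. Identify $S^3$ with the group $Sp(1)$ of unit quaternions, with the bi-invariant metric $g_{S^3}$ for which the left-invariant frame $v_1,v_2,v_3$, whose values at the identity are positive multiples of $i,j,k$ respectively, is orthonormal and satisfies $[v_1,v_2]=Dv_3$, $[v_2,v_3]=Dv_1$, $[v_3,v_1]=Dv_2$; put $\sigma_1=g_{S^3}(v_1,\cdot)$. Let $S^1_i=\{a+bi:a^2+b^2=1\}\subset Sp(1)=S^3$ (the fixed set of conjugation by $i$) and $\sigma=\sigma_1|_{S^1_i}$, the unit-length one-form dual to $v_1|_{S^1_i}$. Fields, forms and metrics on the factors are pulled back to the product without change of notation. *)

(* Defs.v *)
From HB Require Import structures.
From mathcomp Require Import all_boot all_order all_algebra.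
From mathcomp Require Import all_classical all_reals all_analysis.

Set Implicit Arguments.
Unset Strict Implicit.
Unset Printing Implicit Defensive.

Import Order.TTheory GRing.Theory Num.Theory.
Import numFieldNormedType.Exports.

Local Open Scope classical_set_scope.
Local Open Scope ring_scope.

(* Riemannian geometry of a closed embedded submanifold [M] of a
   finite-dimensional real vector space [V].  Functions and vector fields on
   [M] are represented by smooth extensions to [V]; these always exist because
   [M] is closed.  Only values and derivatives along [M] are ever used, and
   those do not depend on the extension. *)

Section Smooth.
Context {R : realType} {V W : normedModType R}.

(* [f] is of class C^n on the open set [U]: in finite dimension this amounts to
   differentiability together with C^(n-1) directional derivatives. *)
Fixpoint Ck_on (n : nat) (U : set V) (f : V -> W) : Prop :=
  match n with
  | 0%N => forall x, U x -> {for x, continuous f}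
  | n'.+1 => (forall x, U x -> differentiable f x) /\
             (forall v : V, Ck_on n' U (fun x => 'D_v f x))
  end.

Definition smooth_on (U : set V) (f : V -> W) : Prop :=
  forall n, Ck_on n U f.

Definition smooth (f : V -> W) : Prop := smooth_on setT f.

End Smooth.

Section Submanifold.
Context {R : realType} {V : normedModType R}.
Implicit Types (M : set V) (g : V -> V -> V -> R) (X Y Z T : V -> V).
Implicit Types (nabla : (V -> V) -> (V -> V) -> V -> V).

Definition tangent M (x : V) : set V :=
  [set v | exists c : R -> V,
     [/\ smooth c, forall t, M (c t), c 0 = x & derive1 c 0 = v]].

Definition vector_field M X : Prop :=
  smooth X /\ forall x, M x -> tangent M x (X x).

Definition riemannian_metric M g : Prop :=
  [/\ forall x, M x -> forall a b, tangent M x a -> tangent M x b ->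
        g x a b = g x b a,
      forall x, M x -> forall (k : R) a b c,
        tangent M x a -> tangent M x b -> tangent M x c ->
        g x (k *: a + b) c = k * g x a c + g x b c,
      forall x, M x -> forall a, tangent M x a -> a != 0 -> 0 < g x a a
    & forall X Y, vector_field M X -> vector_field M Y ->
        smooth (fun x => g x (X x) (Y x))].

Definition lie_bracket X Y (x : V) : V := 'D_(X x) Y x - 'D_(Y x) X x.

Definition affine_connection M nabla : Prop :=
  [/\ forall X Y, vector_field M X -> vector_field M Y ->
        vector_field M (nabla X Y),
      forall X X' Y, vector_field M X -> vector_field M X' ->
        vector_field M Y -> forall x, M x ->
        nabla (fun y => X y + X' y) Y x = nabla X Y x + nabla X' Y x,
      forall (f : V -> R) X Y, smooth f -> vector_field M X ->
        vector_field M Y -> forall x, M x ->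
        nabla (fun y => f y *: X y) Y x = f x *: nabla X Y x,
      forall X Y Y', vector_field M X -> vector_field M Y ->
        vector_field M Y' -> forall x, M x ->
        nabla X (fun y => Y y + Y' y) x = nabla X Y x + nabla X Y' x
    & forall (f : V -> R) X Y, smooth f -> vector_field M X ->
        vector_field M Y -> forall x, M x ->
        nabla X (fun y => f y *: Y y) x =
          'D_(X x) f x *: Y x + f x *: nabla X Y x].

Definition levi_civita M g nabla : Prop :=
  [/\ affine_connection M nabla,
      forall X Y, vector_field M X -> vector_field M Y ->
        forall x, M x -> nabla X Y x - nabla Y X x = lie_bracket X Y x
    & forall X Y Z, vector_field M X -> vector_field M Y ->
        vector_field M Z -> forall x, M x ->
        'D_(X x) (fun y => g y (Y y) (Z y)) x =
          g x (nabla X Y x) (Z x) + g x (Y x) (nabla X Z x)].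

Definition curvature nabla X Y Z (x : V) : V :=
  nabla X (nabla Y Z) x - nabla Y (nabla X Z) x - nabla (lie_bracket X Y) Z x.

Definition sectional_curvature g nabla X Y (x : V) : R :=
  g x (curvature nabla X Y Y x) (X x) /
  (g x (X x) (X x) * g x (Y x) (Y x) - g x (X x) (Y x) ^+ 2).

(* One-dimensional foliations are given by a nowhere vanishing vector field
   [T] on [M]; the leaves are its maximal integral curves (complete, as all
   the manifolds considered here are compact). *)
Definition generates_foliation M T : Prop :=
  vector_field M T /\ forall x, M x -> T x != 0.

Definition leaf_direction T (x : V) : set V :=
  [set v | exists k : R, v = k *: T x].

Definition leaf M T (x : V) : set V :=
  [set y | exists c : R -> V,
     [/\ forall t, M (c t), forall t : R, is_derive t 1 c (T (c t)),
         c 0 = x & exists t, c t = y]].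

(* Vanishing of the second fundamental form of the leaves. *)
Definition totally_geodesic M g T : Prop :=
  forall nabla, levi_civita M g nabla ->
  forall X Y, vector_field M X -> vector_field M Y ->
    (forall x, M x -> leaf_direction T x (X x)) ->
    (forall x, M x -> leaf_direction T x (Y x)) ->
    forall x, M x -> leaf_direction T x (nabla X Y x).

(* The field [X] is an arbitrary extension of a nonzero vector at [x]
   orthogonal to the leaf. *)
Definition Kmix_positive M g T : Prop :=
  forall nabla, levi_civita M g nabla ->
  forall x X, M x -> vector_field M X ->
    X x != 0 -> g x (X x) (T x) = 0 ->
    0 < sectional_curvature g nabla X T x.

Definition curve_length g (c : R -> V) (a b : R) : \bar R :=
  (\int[lebesgue_measure]_(t in `[a, b])
     (Num.sqrt (g (c t) (derive1 c t) (derive1 c t)))%:E)%E.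

(* [S] is a smoothly embedded closed circle of [g]-length [l]. *)
Definition closed_circle_of_length g (S : set V) (l : R) : Prop :=
  exists (c : R -> V) (b : R),
    [/\ 0 < b,
        smooth c /\ (forall t, derive1 c t != 0),
        (forall t, c (t + b) = c t) /\
          (forall s t, 0 <= s < b -> 0 <= t < b -> c s = c t -> s = t),
        S = range c
      & curve_length g c 0 b = l%:E].

Definition riemannian_submersion_on M g d (U : set V)
    (f : V -> 'rV[R]_d) (B : set 'rV[R]_d) (gB : 'rV[R]_d -> 'M[R]_d) : Prop :=
  [/\ smooth_on U f /\ (forall x, U x -> M x -> B (f x)),
      open B /\ smooth_on B gB,
      forall y, B y -> (gB y)^T = gB y /\
        forall w : 'rV[R]_d, w != 0 -> 0 < (w *m gB y *m w^T) 0 0,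
      forall x, U x -> M x -> forall w : 'rV[R]_d,
        exists2 a, tangent M x a & 'D_a f x = w
    & forall x, U x -> M x -> forall a b, tangent M x a -> tangent M x b ->
        (forall k, tangent M x k -> 'D_k f x = 0 ->
           g x a k = 0 /\ g x b k = 0) ->
        g x a b = ('D_a f x *m gB (f x) *m ('D_b f x)^T) 0 0].

(* Being local, the base may be taken to be an open subset of some R^d.  The
   fibers of a submersion are leaves exactly when its vertical spaces are the
   leaf directions. *)
Definition bundle_like M g T : Prop :=
  forall x, M x -> exists U : set V, [/\ open U, U x &
    exists d (f : V -> 'rV[R]_d) (B : set 'rV[R]_d) (gB : 'rV[R]_d -> 'M[R]_d),
      riemannian_submersion_on M g U f B gB /\
      forall y, U y -> M y -> forall a, tangent M y a ->
        ('D_a f y = 0 <-> leaf_direction T y a)].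

End Submanifold.

Section Quaternions.
Context {R : realType}.

(* The row [(a, b, c, d)] stands for a + b i + c j + d k. *)
Definition qmul (x y : 'rV[R]_4) : 'rV[R]_4 :=
  let: (a, b, c, d) := (x 0 0, x 0 1, x 0 2, x 0 3) in
  let: (a', b', c', d') := (y 0 0, y 0 1, y 0 2, y 0 3) in
  \row_(l < 4) [:: a * a' - b * b' - c * c' - d * d';
                   a * b' + b * a' + c * d' - d * c';
                   a * c' - b * d' + c * a' + d * b';
                   a * d' + b * c' - c * b' + d * a']`_l.

Definition qi : 'rV[R]_4 := delta_mx 0 1.
Definition qj : 'rV[R]_4 := delta_mx 0 2.
Definition qk : 'rV[R]_4 := delta_mx 0 3.

(* H^m is the space of matrices with [m] quaternionic rows. *)
Definition qscaler m (x : 'M[R]_(m, 4)) (y : 'rV[R]_4) : 'M[R]_(m, 4) :=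
  \matrix_(l < m) qmul (row l x) y.

Definition dot m n (x y : 'M[R]_(m, n)) : R :=
  \sum_(k < m) \sum_(l < n) x k l * y k l.

End Quaternions.

Section Metric.
Context {R : realType}.
Variables (m : nat) (A C D p q : R).
Implicit Types (x a b : 'M[R]_(m, 4)) (z w : 'rV[R]_4).

Definition qsphere : set 'M[R]_(m, 4) := [set x | dot x x = 1].

Definition xi1 x := qscaler x qi.
Definition xi2 x := qscaler x qj.
Definition xi3 x := qscaler x qk.

Definition u1 x := (Num.sqrt (A * C) / 2) *: xi1 x.
Definition u2 x := (A / 2) *: xi2 x.
Definition u3 x := (Num.sqrt (A * C) / 2) *: xi3 x.

Definition gAC x a b : R :=
  let L := 2 / Num.sqrt (A * C) in
  let M := 2 / A in
  L ^+ 2 * dot a b + (M ^+ 2 - L ^+ 2) * (dot (xi2 x) a * dot (xi2 x) b).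

Definition beta1 x a : R := gAC x (u1 x) a.
Definition beta3 x a : R := gAC x (u3 x) a.

Definition circle_i : set 'rV[R]_4 :=
  [set z | z 0 0 ^+ 2 + z 0 1 ^+ 2 = 1 /\ z 0 2 = 0 /\ z 0 3 = 0].

(* For z |-> lambda (z i), z |-> lambda (z j), z |-> lambda (z k) the bracket
   relations force 2 lambda = D, so the metric on Sp(1) is (2/D)^2 times the
   round one. *)
Definition v1 z : 'rV[R]_4 := (D / 2) *: qmul z qi.
Definition gS3 z w w' : R := (2 / D) ^+ 2 * dot w w'.
Definition sigma z w : R := gS3 z (v1 z) w.

Definition ambient : normedModType R := ('M[R]_(m, 4) * 'rV[R]_4)%type.

Definition Pm : set ambient := [set y | qsphere y.1 /\ circle_i y.2].

Definition gP (y a b : ambient) : R :=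
  gAC y.1 a.1 b.1 + sigma y.2 a.2 * sigma y.2 b.2
  + p * (beta1 y.1 a.1 * sigma y.2 b.2 + sigma y.2 a.2 * beta1 y.1 b.1)
  + q * (beta3 y.1 a.1 * sigma y.2 b.2 + sigma y.2 a.2 * beta3 y.1 b.1).

Definition TP (y : ambient) : ambient := (u1 y.1, 0).

End Metric.

(* Main.v *)
(** A geodesic unit field T is controlled by h = L_T g and d(T^flat): for every field X,
    g(R(X,T)T, X) = |nabla_X T|^2 - (L_T h)(X, X) / 2, where
    2 g(nabla_X T, Z) = h(X, Z) + d(T^flat)(X, Z).  Here L_T only rotates eta_2 and eta_3
    into each other and kills eta_1 and sigma, so all these forms are explicit.  For X
    orthogonal to T with beta-components x_2, x_3, with sigma(X) = s and with part X_h
    orthogonal to the quaternionic lines, testing nabla_X T against a single vector gives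
    g(R(X,T)T, X) >= |X_h|^2 + (C x_3 + q A s)^2 / 4 + C (A - C) x_3^2 + C^2 x_2^2 / 4,
    with |X_h| the Euclidean norm, which is positive because q <> 0.

    If the foliation were bundle-like, the flow of T would preserve g on vectors orthogonal
    to T.  It rotates u_2 towards u_3 and thereby changes its length, since A <> C. *)
Require Import Defs.
From HB Require Import structures.
From mathcomp Require Import all_boot all_order all_algebra.
From mathcomp Require Import all_classical all_reals all_analysis.
From mathcomp Require Import ring lra.

Set Implicit Arguments.
Unset Strict Implicit.
Unset Printing Implicit Defensive.

Import Order.TTheory GRing.Theory Num.Theory.
Import numFieldNormedType.Exports.

Local Open Scope classical_set_scope.
Local Open Scope ring_scope.

(** The connection [nabla] is an arbitrary operator on ambient extensions of fields, constrained
    only along the manifold, and it is never written out: [nabla X T] is known only through its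
    pairings [omega] with tangent fields. Its exact g-norm would require inverting a metric in which
    eta_1, eta_3 and sigma are coupled by p and q. The inequality |W|^2 >= 2 g(W, z) - g(z, z)
    avoids this, with z taken in the span of xi_2, xi_3 and the horizontal part, where g is
    diagonal. The same setting makes locality a real issue: [nabla T T] vanishes only on the
    manifold, yet the curvature differentiates it again.

    Since A > C, the coefficient [kap] is negative, so the second-order term helps eta_3 and hurts
    eta_2. The loss in eta_2 is repaid by |nabla_X T|^2, and the mixed term in eta_3 and sigma
    merely flips a sign inside a square. That square is the only term of the bound that sees
    sigma(X), which is where q enters. *)

Section Calculus.
Context {R : realType}.
Implicit Types (U V W : normedModType R).

Notation Ck n f := (Ck_on n setT f).

Lemma CkS n V W (f : V -> W) : Ck n.+1 f ->
  (forall x, differentiable f x) /\ (forall v, Ck n (fun x => 'D_v f x)).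
Proof. by case=> df Df; split=> // x; exact: df. Qed.

Lemma CkW n V W (f : V -> W) : Ck n.+1 f -> Ck n f.
Proof.
elim: n f => [|n IH] f [df Df].
  by move=> x _; apply: differentiable_continuous; exact: df.
by split=> // v; exact: IH (Df v).
Qed.

Lemma smooth_differentiable V W (f : V -> W) x : smooth f -> differentiable f x.
Proof. by move=> sf; have [df _] := sf 1%N; exact: df. Qed.

Lemma Ck_cst n {V W} (a : W) : Ck n (fun _ : V => a).
Proof.
elim: n a => [|n IH] a; first by move=> x _; exact: cst_continuous.
split=> [x _|v]; first exact: differentiable_cst.
by under eq_fun do rewrite derive_cst; exact: IH.
Qed.

Lemma smooth_cst {V W} (a : W) : smooth (fun _ : V => a).
Proof. by move=> n; exact: Ck_cst. Qed.

Lemma Ck_add n V W (f g : V -> W) : Ck n f -> Ck n g -> Ck n (fun x => f x + g x).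
Proof.
elim: n f g => [|n IH] f g.
  by move=> cf cg x _; apply: continuousD; [exact: cf|exact: cg].
move=> /CkS[df Df] /CkS[dg Dg]; split=> [x _|v].
  by apply: differentiableD; [exact: df|exact: dg].
rewrite (_ : (fun x => _) = fun x => 'D_v f x + 'D_v g x).
  exact: (IH (fun x => 'D_v f x) (fun x => 'D_v g x)).
by apply/funext => x; rewrite deriveD//; apply: diff_derivable; (exact: df || exact: dg).
Qed.

Lemma smoothD V W (f g : V -> W) : smooth f -> smooth g -> smooth (fun x => f x + g x).
Proof. by move=> sf sg n; exact: Ck_add. Qed.

Lemma smooth_sum V W (I : Type) (r : seq I) (f : I -> V -> W) :
  (forall i, smooth (f i)) -> smooth (fun x => \sum_(i <- r) f i x).
Proof.
move=> sf; elim: r => [|i r IH].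
  by under eq_fun do rewrite big_nil; exact: smooth_cst.
by under eq_fun do rewrite big_cons; exact: smoothD.
Qed.

(** * Leibniz rules for continuous bilinear and linear maps *)

Section Bilinear.
Variables (V1 V2 V W : normedModType R) (B : {bilinear V1 -> V2 -> W}).
Hypothesis cB : continuous (fun p => B p.1 p.2).
Implicit Types (f : V -> V1) (g : V -> V2).

Lemma differentiable_bilinear f g x : differentiable f x -> differentiable g x ->
  differentiable (fun y => B (f y) (g y)) x.
Proof.
move=> df dg.
apply: (@differentiable_comp _ _ _ _ (fun y => (f y, g y)) (fun p => B p.1 p.2)).
  exact: differentiable_pair.
exact: differentiable_bilin.
Qed.

Lemma derive_bilinear f g x v : differentiable f x -> differentiable g x ->
  'D_v (fun y => B (f y) (g y)) x = B ('D_v f x) (g x) + B (f x) ('D_v g x).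
Proof.
move=> df dg; rewrite deriveE; last exact: differentiable_bilinear.
rewrite (@diff_comp _ _ _ _ (fun y => (f y, g y)) (fun p => B p.1 p.2))//; last first.
- exact: differentiable_bilin.
- exact: differentiable_pair.
by rewrite /= diff_pair// diff_bilin//= addrC !deriveE.
Qed.

Lemma Ck_bilinear n f g : Ck n f -> Ck n g -> Ck n (fun y => B (f y) (g y)).
Proof.
elim: n f g => [|n IH] f g.
  move=> cf cg x _.
  apply: (@continuous_comp _ _ _ (fun y => (f y, g y)) (fun p => B p.1 p.2)).
    by apply: cvg_pair; [exact: cf|exact: cg].
  exact: cB.
(* Each Leibniz summand has one differentiated and one undifferentiated factor; [CkW] lowers the
   latter to the common order. *)
move=> /[dup] /CkW cf /CkS[df Df] /[dup] /CkW cg /CkS[dg Dg]; split=> [x _|v].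
  by apply: differentiable_bilinear; [exact: df|exact: dg].
rewrite (_ : (fun x => _) = fun x => B ('D_v f x) (g x) + B (f x) ('D_v g x)).
  by apply: Ck_add; [exact: (IH (fun x => 'D_v f x) g)|exact: (IH f (fun x => 'D_v g x))].
by apply/funext => x; rewrite derive_bilinear//; (exact: df || exact: dg).
Qed.

Lemma smooth_bilinear f g : smooth f -> smooth g -> smooth (fun y => B (f y) (g y)).
Proof. by move=> sf sg n; exact: Ck_bilinear. Qed.

End Bilinear.

Section Linear.
Variables (U V W : normedModType R) (L : {linear V -> W}).
Hypothesis cL : continuous L.
Implicit Types (f : U -> V).

Lemma differentiable_linear f x : differentiable f x -> differentiable (fun y => L (f y)) x.
Proof. by move=> df; apply: (differentiable_comp df); exact: linear_differentiable. Qed.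

Lemma derive_linear f x v : differentiable f x ->
  'D_v (fun y => L (f y)) x = L ('D_v f x).
Proof.
move=> df; rewrite deriveE; last exact: differentiable_linear.
have dL := linear_differentiable (f x) cL.
by rewrite (diff_comp df dL)/= (diff_lin _ cL) deriveE.
Qed.

Lemma Ck_linear n f : Ck n f -> Ck n (fun y => L (f y)).
Proof.
elim: n f => [|n IH] f.
  by move=> cf x _; apply: continuous_comp; [exact: cf|exact: cL].
move=> /CkS[df Df]; split=> [x _|v]; first by apply: differentiable_linear; exact: df.
rewrite (_ : (fun x => _) = fun x => L ('D_v f x)); first exact: (IH (fun x => 'D_v f x)).
by apply/funext => x; rewrite derive_linear//; exact: df.
Qed.

Lemma smooth_linear f : smooth f -> smooth (fun y => L (f y)).
Proof. by move=> sf n; exact: Ck_linear. Qed.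

End Linear.

Lemma Ck_pair n U V W (f : U -> V) (g : U -> W) :
  Ck n f -> Ck n g -> Ck n (fun y => (f y, g y)).
Proof.
elim: n f g => [|n IH] f g.
  by move=> cf cg x _; apply: cvg_pair; [exact: cf|exact: cg].
move=> /CkS[df Df] /CkS[dg Dg]; split=> [x _|v].
  by apply: differentiable_pair; [exact: df|exact: dg].
rewrite (_ : (fun x => _) = fun x => ('D_v f x, 'D_v g x)).
  exact: (IH (fun x => 'D_v f x) (fun x => 'D_v g x)).
apply/funext => x; have [dfx dgx] := (df x, dg x).
rewrite deriveE; last exact: differentiable_pair.
by rewrite diff_pair//= !deriveE.
Qed.

Lemma smooth_pair U V W (f : U -> V) (g : U -> W) :
  smooth f -> smooth g -> smooth (fun y => (f y, g y)).
Proof. by move=> sf sg n; exact: Ck_pair. Qed.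

Lemma derive_pair U V W (f : U -> V) (g : U -> W) x v :
  differentiable f x -> differentiable g x ->
  'D_v (fun y => (f y, g y)) x = ('D_v f x, 'D_v g x).
Proof.
move=> df dg; rewrite deriveE; last exact: differentiable_pair.
by rewrite diff_pair//= !deriveE.
Qed.

Lemma smooth_id {V} : smooth (fun x : V => x).
Proof.
case=> [|n]; first by move=> x _; exact: cvg_id.
split=> [x _|v]; first exact: ex_diff.
by under eq_fun do rewrite derive_id; exact: Ck_cst.
Qed.

Lemma continuous_fst V W : continuous (fst : V * W -> V).
Proof. by move=> x; exact: cvg_fst. Qed.

Lemma continuous_snd V W : continuous (snd : V * W -> W).
Proof. by move=> x; exact: cvg_snd. Qed.

Lemma smooth_fst U V W (f : U -> V * W) : smooth f -> smooth (fun y => (f y).1).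
Proof. exact: (smooth_linear (L := fst) (@continuous_fst V W)). Qed.

Lemma smooth_snd U V W (f : U -> V * W) : smooth f -> smooth (fun y => (f y).2).
Proof. exact: (smooth_linear (L := snd) (@continuous_snd V W)). Qed.

Lemma differentiable_fst U V W (f : U -> V * W) x :
  differentiable f x -> differentiable (fun y => (f y).1) x.
Proof. exact: (differentiable_linear (L := fst) (@continuous_fst V W)). Qed.

Lemma differentiable_snd U V W (f : U -> V * W) x :
  differentiable f x -> differentiable (fun y => (f y).2) x.
Proof. exact: (differentiable_linear (L := snd) (@continuous_snd V W)). Qed.

Lemma derive_fst U V W (f : U -> V * W) x v : differentiable f x ->
  'D_v (fun y => (f y).1) x = ('D_v f x).1.
Proof. exact: (derive_linear (L := fst) (@continuous_fst V W)). Qed.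

Lemma derive_snd U V W (f : U -> V * W) x v : differentiable f x ->
  'D_v (fun y => (f y).2) x = ('D_v f x).2.
Proof. exact: (derive_linear (L := snd) (@continuous_snd V W)). Qed.

Section Scaling.
Variables V W : normedModType R.
Implicit Types (k : V -> R) (f : V -> W).

Let scale_bilinear : bilinear_for
  (GRing.Scale.Law.clone _ _ *:%R _) (GRing.Scale.Law.clone _ _ *:%R _)
  (@GRing.scale R W).
Proof.
split=> [u'|u] a x y /=.
- by rewrite scalerDl scalerA.
- by rewrite scalerDr !scalerA mulrC.
Qed.

Let scaleM := bilinear_isBilinear.Build R R W W _ _ (@GRing.scale R W) scale_bilinear.
Let scaleB : {bilinear R -> W -> W} := HB.pack (@GRing.scale R W) scaleM.

Let scaleC : continuous (fun p => scaleB p.1 p.2).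
Proof. exact: scale_continuous. Qed.

Lemma smoothZ k f : smooth k -> smooth f -> smooth (fun x => k x *: f x).
Proof. exact: (smooth_bilinear (B := scaleB) scaleC). Qed.

Lemma differentiable_scale k f x : differentiable k x -> differentiable f x ->
  differentiable (fun x => k x *: f x) x.
Proof. exact: (differentiable_bilinear (B := scaleB) scaleC). Qed.

Lemma derive_scale k f x v : differentiable k x -> differentiable f x ->
  'D_v (fun x => k x *: f x) x = 'D_v k x *: f x + k x *: 'D_v f x.
Proof. exact: (derive_bilinear (B := scaleB) scaleC). Qed.

End Scaling.

Lemma smoothM V (f g : V -> R) : smooth f -> smooth g -> smooth (fun x => f x * g x).
Proof. exact: smoothZ. Qed.

Lemma derive1_comp_curve V W (f : V -> W) (c : R -> V) t :
  differentiable f (c t) -> differentiable c t ->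
  'D_(derive1 c t) f (c t) = derive1 (fun s => f (c s)) t.
Proof.
move=> df dc; rewrite [RHS]derive1E [RHS]deriveE; last exact: (differentiable_comp dc df).
by rewrite [RHS](congr1 (@^~ 1) (diff_comp dc df))/= deriveE// derive1E (deriveE _ dc).
Qed.

(** A tangent vector is the velocity of a curve inside [M], and along that curve the two functions
    coincide. All independence of ambient extensions rests on this. *)
Lemma derive_tangent_eq V W (M : set V) (f g : V -> W) x v :
  differentiable f x -> differentiable g x -> (forall y, M y -> f y = g y) ->
  tangent M x v -> 'D_v f x = 'D_v g x.
Proof.
move=> df dg fg [c [sc Mc cx <-]]; move: df dg; rewrite -cx => df dg.
rewrite !derive1_comp_curve//; try exact: smooth_differentiable.
by congr (derive1 _ 0); apply/funext => t; exact: fg.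
Qed.

End Calculus.

(** * Levi-Civita connections of submanifolds *)

Section LeviCivita.
Context {R : realType} {V : normedModType R}.
Variables (M : set V) (g : V -> V -> V -> R) (nabla : (V -> V) -> (V -> V) -> V -> V).
Implicit Types (X Y Z T : V -> V) (x : V).

Hypothesis gC : forall x a b, g x a b = g x b a.
Hypothesis g_linear : forall x k a b c, g x (k *: a + b) c = k * g x a c + g x b c.
Hypothesis g_metric : riemannian_metric M g.
Hypothesis tangent_linear : forall x k a b, M x ->
  tangent M x a -> tangent M x b -> tangent M x (k *: a + b).
(** [smooth] speaks of derivatives in fixed directions, so smoothness of a bracket needs a basis; it
    is supplied later for the concrete ambient space. *)
Hypothesis smooth_bracket : forall X Y,
  vector_field M X -> vector_field M Y -> smooth (lie_bracket X Y).
Hypothesis nablaP : levi_civita M g nabla.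

Local Notation vf := (vector_field M).

Lemma form0l x c : g x 0 c = 0.
Proof. by have := g_linear x 1 0 0 c; rewrite scale1r addr0 mul1r; lra. Qed.

Lemma formDl x a b c : g x (a + b) c = g x a c + g x b c.
Proof. by have := g_linear x 1 a b c; rewrite scale1r mul1r. Qed.

Lemma formZl x k a c : g x (k *: a) c = k * g x a c.
Proof. by have := g_linear x k a 0 c; rewrite addr0 form0l addr0. Qed.

Lemma formBl x a b c : g x (a - b) c = g x a c - g x b c.
Proof. by rewrite formDl -scaleN1r formZl mulN1r. Qed.

Lemma formNl x a c : g x (- a) c = - g x a c.
Proof. by rewrite -sub0r formBl form0l sub0r. Qed.

Lemma formBr x a b c : g x c (a - b) = g x c a - g x c b.
Proof. by rewrite gC formBl !(gC _ c). Qed.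

Lemma vector_field0 : vf (fun=> 0).
Proof.
split=> [|x Mx]; first exact: smooth_cst.
by exists (fun=> x); split=> //; [exact: smooth_cst|rewrite derive1_cst].
Qed.

Lemma vector_fieldZD (k : V -> R) X Y : smooth k -> vf X -> vf Y ->
  vf (fun y => k y *: X y + Y y).
Proof.
move=> sk [sX tX] [sY tY]; split=> [|x Mx]; first exact/smoothD/sY/smoothZ.
by apply: tangent_linear => //; [exact: tX|exact: tY].
Qed.

Lemma vector_fieldB X Y : vf X -> vf Y -> vf (fun y => X y - Y y).
Proof.
move=> vX vY; have := vector_fieldZD (smooth_cst (-1 : R)) vY vX.
by rewrite (_ : (fun y => _) = fun y => X y - Y y)//; apply/funext => y; rewrite scaleN1r addrC.
Qed.

Lemma vector_fieldZ (k : V -> R) X : smooth k -> vf X -> vf (fun y => k y *: X y).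
Proof.
move=> sk vX; have := vector_fieldZD sk vX vector_field0.
by rewrite (_ : (fun y => _) = fun y => k y *: X y)//; apply/funext => y; rewrite addr0.
Qed.

Lemma vector_field_nabla X Y : vf X -> vf Y -> vf (nabla X Y).
Proof. by case: nablaP => -[+ _ _ _ _] _ _; exact. Qed.

Lemma torsion_free X Y x : vf X -> vf Y -> M x ->
  nabla X Y x - nabla Y X x = lie_bracket X Y x.
Proof. by case: nablaP => _ + _; move=> h ? ? ?; exact: h. Qed.

Lemma metric_compatible X Y Z x : vf X -> vf Y -> vf Z -> M x ->
  'D_(X x) (fun y => g y (Y y) (Z y)) x = g x (nabla X Y x) (Z x) + g x (Y x) (nabla X Z x).
Proof. by case: nablaP => _ _ h ? ? ? ?; exact: h. Qed.

(** Tangency comes for free from torsion-freeness: the bracket is a difference of covariant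
    derivatives, which are tangent by the connection axioms. *)
Lemma vector_field_bracket X Y : vf X -> vf Y -> vf (lie_bracket X Y).
Proof.
move=> vX vY; split=> [|x Mx]; first exact: smooth_bracket.
rewrite -torsion_free//.
have [_ h] := vector_fieldB (vector_field_nabla vX vY) (vector_field_nabla vY vX).
exact: h.
Qed.

Lemma vector_field_metric X Y : vf X -> vf Y -> smooth (fun x => g x (X x) (Y x)).
Proof. by case: g_metric => _ _ _; exact. Qed.

Lemma vector_field_eq0 X x : vf X -> M x -> (forall Z, vf Z -> g x (X x) (Z x) = 0) -> X x = 0.
Proof.
move=> vX Mx X0; apply/eqP/negPn/negP => Xn0.
by have [_ _ gpos _] := g_metric; have := gpos x Mx _ (vX.2 _ Mx) Xn0; rewrite X0// ltxx.
Qed.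

Lemma vector_field_eq X Y x : vf X -> vf Y -> M x ->
  (forall Z, vf Z -> g x (X x) (Z x) = g x (Y x) (Z x)) -> X x = Y x.
Proof.
move=> vX vY Mx XY; apply/eqP; rewrite -subr_eq0; apply/eqP.
apply: (@vector_field_eq0 (fun y => X y - Y y)) => //; first exact: vector_fieldB.
by move=> Z vZ; rewrite formBl XY// subrr.
Qed.

(** Differentiate g(Y, Z) = g(Y', Z) in the tangent direction [X x]: the terms with nabla_X Z agree,
    so both covariant derivatives pair equally with every [Z]. *)
Lemma nabla_congr_r X Y Y' x : vf X -> vf Y -> vf Y' -> (forall y, M y -> Y y = Y' y) ->
  M x -> nabla X Y x = nabla X Y' x.
Proof.
move=> vX vY vY' YY' Mx; apply: vector_field_eq; [exact: vector_field_nabla..|by []|].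
move=> Z vZ; have := metric_compatible vX vY vZ Mx; have := metric_compatible vX vY' vZ Mx.
rewrite (derive_tangent_eq (f := fun y => g y (Y y) (Z y))
  (g := fun y => g y (Y' y) (Z y)) _ _ _ (vX.2 _ Mx)).
- by move=> -> /eqP; rewrite YY'// => /eqP/addIr.
- exact/smooth_differentiable/vector_field_metric.
- exact/smooth_differentiable/vector_field_metric.
- by move=> y My; rewrite YY'.
Qed.

Lemma bracket_congr_l X X' Y x : vf X -> vf X' -> vf Y -> (forall y, M y -> X y = X' y) ->
  M x -> lie_bracket X Y x = lie_bracket X' Y x.
Proof.
move=> vX vX' vY XX' Mx; rewrite /lie_bracket XX'//; congr (_ - _).
apply: (derive_tangent_eq _ _ XX' (vY.2 _ Mx)); apply: smooth_differentiable.
- exact: vX.1.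
- exact: vX'.1.
Qed.

(** Torsion-freeness swaps the two arguments and reduces the claim to [nabla_congr_r]; the bracket
    too depends only on values along [M]. *)
Lemma nabla_congr_l X X' Y x : vf X -> vf X' -> vf Y -> (forall y, M y -> X y = X' y) ->
  M x -> nabla X Y x = nabla X' Y x.
Proof.
move=> vX vX' vY XX' Mx; have := torsion_free vX vY Mx.
rewrite (bracket_congr_l vX vX' vY XX' Mx) -(torsion_free vX' vY Mx).
by rewrite (nabla_congr_r vY vX vX' XX' Mx) => /addIr.
Qed.

Lemma koszul X Y Z x : vf X -> vf Y -> vf Z -> M x ->
  2 * g x (nabla X Y x) (Z x) =
    'D_(X x) (fun y => g y (Y y) (Z y)) x + 'D_(Y x) (fun y => g y (X y) (Z y)) x
    - 'D_(Z x) (fun y => g y (X y) (Y y)) x + g x (lie_bracket X Y x) (Z x)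
    - g x (lie_bracket X Z x) (Y x) - g x (lie_bracket Y Z x) (X x).
Proof.
move=> vX vY vZ Mx; rewrite !metric_compatible// -!torsion_free// !formBl.
by rewrite !(gC x (X x)) !(gC x (Y x)); ring.
Qed.

(** The Koszul formula in flat ambient coordinates: the bracket terms absorb the derivatives of the
    fields except D_X Y, leaving the Christoffel symbols of the first kind in terms of [dg]. *)
Lemma christoffel (dg : V -> V -> V -> V -> R) X Y Z x :
  (forall X' Y' x' v, smooth X' -> smooth Y' ->
    'D_v (fun y => g y (X' y) (Y' y)) x' =
      dg v x' (X' x') (Y' x') + g x' ('D_v X' x') (Y' x') + g x' (X' x') ('D_v Y' x')) ->
  vf X -> vf Y -> vf Z -> M x ->
  2 * g x (nabla X Y x) (Z x) =
    dg (X x) x (Y x) (Z x) + dg (Y x) x (X x) (Z x) - dg (Z x) x (X x) (Y x)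
    + 2 * g x ('D_(X x) Y x) (Z x).
Proof.
move=> derive_g vX vY vZ Mx; rewrite koszul// !derive_g//; try by [exact: vX.1|exact: vY.1|exact: vZ.1].
rewrite /lie_bracket !formBl !(gC x (X x)) !(gC x (Y x)); ring.
Qed.

Lemma nabla0 X x : vf X -> M x -> nabla X (fun=> 0) x = 0.
Proof.
move=> vX Mx; case: nablaP => -[_ _ _ _ h] _ _.
have := h (fun=> 0) _ _ (smooth_cst (0 : R)) vX vector_field0 x Mx.
by under eq_fun do rewrite scale0r; rewrite derive_cst !scale0r addr0.
Qed.

Section GeodesicField.
Variable T : V -> V.
Hypothesis vT : vf T.
Hypothesis T_unit : forall x, M x -> g x (T x) (T x) = 1.
Hypothesis T_geodesic : forall x, M x -> nabla T T x = 0.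

Lemma geodesic_field_totally_geodesic X Y x : vf X -> vf Y ->
  (forall y, M y -> leaf_direction T y (X y)) ->
  (forall y, M y -> leaf_direction T y (Y y)) ->
  M x -> leaf_direction T x (nabla X Y x).
Proof.
move=> vX vY lX lY Mx.
(* [leaf_direction] gives a coefficient point by point, without smoothness; for unit [T] it equals
   g(Z, T), which is smooth, so linearity over functions and the Leibniz rule apply. *)
have along Z : vf Z -> (forall y, M y -> leaf_direction T y (Z y)) ->
    forall y, M y -> Z y = g y (Z y) (T y) *: T y.
  by move=> _ lZ y My; have [k ->] := lZ y My; rewrite formZl T_unit// mulr1.
pose fX y := g y (X y) (T y); pose fY y := g y (Y y) (T y).
have sX : smooth fX by exact: vector_field_metric.
have sY : smooth fY by exact: vector_field_metric.
have vfX := vector_fieldZ sX vT; have vfY := vector_fieldZ sY vT.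
rewrite (nabla_congr_l vX vfX vY (along _ vX lX) Mx).
rewrite (nabla_congr_r vfX vY vfY (along _ vY lY) Mx).
case: nablaP => -[_ _ nablaZ _ leibniz] _ _.
rewrite nablaZ// leibniz// T_geodesic// scaler0 addr0 scalerA.
by exists (fX x * 'D_(T x) fY x).
Qed.

(* Since g(nabla_X T, X) is half the Lie derivative of g along T, this avoids the
   second covariant derivative of T. *)
Lemma geodesic_field_curvature X x : vf X -> M x ->
  g x (curvature nabla X T T x) (X x) =
    g x (nabla X T x) (nabla X T x)
    - 'D_(T x) (fun y => g y (nabla X T y) (X y)) x
    + g x (nabla X T x) (lie_bracket T X x)
    + g x (nabla (lie_bracket T X) T x) (X x).
Proof.
move=> vX Mx; rewrite /curvature.
have vW := vector_field_nabla vX vT.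
(* [nabla T T] is zero only along [M], so it is exchanged for the zero field before being
   differentiated. *)
rewrite (nabla_congr_r vX (vector_field_nabla vT vT) vector_field0 T_geodesic Mx).
rewrite nabla0// sub0r formBl formNl metric_compatible// -torsion_free// formBr.
have -> : nabla (lie_bracket X T) T x = - nabla (lie_bracket T X) T x.
  have vB := vector_field_bracket vT vX.
  have vN := vector_fieldZ (smooth_cst (-1 : R)) vB.
  rewrite (nabla_congr_l (vector_field_bracket vX vT) vN vT)//.
    case: nablaP => -[_ _ nablaZ _ _] _ _.
    by rewrite (nablaZ (fun=> -1)) ?scaleN1r//; exact: smooth_cst.
  by move=> y My; rewrite scaleN1r /lie_bracket opprB.
by rewrite formNl; ring.
Qed.

End GeodesicField.

End LeviCivita.

(** * Continuity and the Euclidean product on matrix spaces *)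

Section MatrixCalculus.
Context {R : realType}.

Lemma mx_linear_continuous m n (W : normedModType R) (L : {linear 'M[R]_(m, n) -> W}) :
  continuous L.
Proof.
have -> : (L : _ -> _) = fun x => \sum_i \sum_j x i j *: L (delta_mx i j).
  apply/funext => x; rewrite {1}(matrix_sum_delta x) linear_sum; apply: eq_bigr => i _.
  by rewrite linear_sum; apply: eq_bigr => j _; rewrite linearZ.
move=> x; do 2![apply: (cvg_big add_continuous (nbhs_filter x)) => ? _].
by apply: cvgZr_tmp; exact: coord_continuous.
Qed.

Section Dot.
Variables m n : nat.
Implicit Types a b c : 'M[R]_(m, n).

Lemma dotC a b : dot a b = dot b a.
Proof. by apply: eq_bigr => k _; apply: eq_bigr => l _; rewrite mulrC. Qed.

Lemma dot_bilinear : bilinear_for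
  (GRing.Scale.Law.clone _ _ *%R _) (GRing.Scale.Law.clone _ _ *%R _)
  (@dot R m n).
Proof.
have lin k u v w : dot (k *: u + v) w = k * dot u w + dot v w :> R.
  rewrite /dot mulr_sumr -big_split/=; apply: eq_bigr => i _.
  rewrite mulr_sumr -big_split/=; apply: eq_bigr => j _; rewrite !mxE; ring.
by split=> [u'|u] k x y /=; rewrite ?lin// dotC lin !(dotC _ u).
Qed.

HB.instance Definition _ :=
  bilinear_isBilinear.Build R 'M[R]_(m, n) 'M[R]_(m, n) R _ _ (@dot R m n) dot_bilinear.

Lemma dot_continuous : continuous (fun p : 'M[R]_(m, n) * 'M[R]_(m, n) => dot p.1 p.2).
Proof.
move=> p; do 2![apply: (cvg_big add_continuous (nbhs_filter p)) => ? _].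
apply: cvgM.
- apply: (continuous_comp (f := fst) (g := fun x : 'M[R]_(m, n) => x _ _)).
    exact: cvg_fst.
  exact: coord_continuous.
- apply: (continuous_comp (f := snd) (g := fun x : 'M[R]_(m, n) => x _ _)).
    exact: cvg_snd.
  exact: coord_continuous.
Qed.

Lemma dotDl a b c : dot (a + b) c = dot a c + dot b c. Proof. exact: linearDl. Qed.
Lemma dotDr a b c : dot c (a + b) = dot c a + dot c b. Proof. exact: linearDr. Qed.
Lemma dotZl k a c : dot (k *: a) c = k * dot a c. Proof. exact: linearZl_LR. Qed.
Lemma dotZr k a c : dot c (k *: a) = k * dot c a. Proof. exact: linearZr_LR. Qed.
Lemma dotNl a c : dot (- a) c = - dot a c. Proof. exact: linearNl. Qed.
Lemma dotNr a c : dot c (- a) = - dot c a. Proof. exact: linearNr. Qed.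
Lemma dotBl a b c : dot (a - b) c = dot a c - dot b c. Proof. exact: linearBl. Qed.
Lemma dotBr a b c : dot c (a - b) = dot c a - dot c b. Proof. exact: linearBr. Qed.
Lemma dot0l c : dot 0 c = 0 :> R. Proof. exact: linear0l. Qed.
Lemma dot0r c : dot c 0 = 0 :> R. Proof. exact: linear0r. Qed.

Lemma dot_ge0 a : 0 <= dot a a.
Proof. by apply: sumr_ge0 => k _; apply: sumr_ge0 => l _; rewrite -expr2 sqr_ge0. Qed.

Lemma dot_eq0 a : dot a a = 0 -> a = 0.
Proof.
have row_ge0 k : 0 <= \sum_l a k l * a k l by apply: sumr_ge0 => l _; rewrite -expr2 sqr_ge0.
move=> /(psumr_eq0P (fun k _ => row_ge0 k)) a0; apply/matrixP => k l; rewrite mxE.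
have /(psumr_eq0P (fun l _ => _)) h := a0 k isT.
by have /eqP := h (fun l => sqr_ge0 (a k l)) l isT; rewrite mulf_eq0 orbb => /eqP.
Qed.

Variable V : normedModType R.
Implicit Types f g : V -> 'M[R]_(m, n).

Lemma smooth_dot f g : smooth f -> smooth g -> smooth (fun y => dot (f y) (g y)).
Proof. exact: (smooth_bilinear dot_continuous). Qed.

Lemma differentiable_dot f g x : differentiable f x -> differentiable g x ->
  differentiable (fun y => dot (f y) (g y)) x.
Proof. exact: (differentiable_bilinear dot_continuous). Qed.

Lemma derive_dot f g x v : differentiable f x -> differentiable g x ->
  'D_v (fun y => dot (f y) (g y)) x = dot ('D_v f x) (g x) + dot (f x) ('D_v g x).
Proof. exact: (derive_bilinear dot_continuous). Qed.

End Dot.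

Lemma dot_delta m n (a : 'M[R]_(m, n)) k l : dot a (delta_mx k l) = a k l.
Proof.
rewrite /dot (bigD1 k)//= (bigD1 l)//= !mxE !eqxx mulr1.
rewrite big1 ?addr0 => [|j /negPf jl]; last by rewrite mxE eqxx jl mulr0.
by rewrite big1 ?addr0// => i /negPf ik; rewrite big1// => j _; rewrite mxE ik mulr0.
Qed.

End MatrixCalculus.

(** * The quaternionic structure *)

Section QuaternionicStructure.
Context {R : realType}.

Lemma ord4P (P : 'I_4 -> Prop) : P 0 -> P 1 -> P 2 -> P 3 -> forall l, P l.
Proof.
move=> P0 P1 P2 P3 [[|[|[|[|l]]]] Hl] //.
- by rewrite (_ : Ordinal Hl = 0)//; apply/val_inj.
- by rewrite (_ : Ordinal Hl = 1)//; apply/val_inj.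
- by rewrite (_ : Ordinal Hl = 2)//; apply/val_inj.
- by rewrite (_ : Ordinal Hl = 3)//; apply/val_inj.
Qed.

Lemma sum4 (f : 'I_4 -> R) : \sum_(l < 4) f l = f 0 + f 1 + f 2 + f 3.
Proof.
rewrite !big_ord_recl big_ord0 addr0 !addrA.
by congr (f _ + f _ + f _ + f _); apply/val_inj.
Qed.

Variable m : nat.
Implicit Types a b x : 'M[R]_(m, 4).

Lemma xi1E x k : [/\ xi1 x k 0 = - x k 1, xi1 x k 1 = x k 0, xi1 x k 2 = x k 3 & xi1 x k 3 = - x k 2].
Proof. by split; rewrite /xi1 /qscaler /qmul /qi !mxE /= ?mxE /=; ring. Qed.

Lemma xi2E x k : [/\ xi2 x k 0 = - x k 2, xi2 x k 1 = - x k 3, xi2 x k 2 = x k 0 & xi2 x k 3 = x k 1].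
Proof. by split; rewrite /xi2 /qscaler /qmul /qj !mxE /= ?mxE /=; ring. Qed.

Lemma xi3E x k : [/\ xi3 x k 0 = - x k 3, xi3 x k 1 = x k 2, xi3 x k 2 = - x k 1 & xi3 x k 3 = x k 0].
Proof. by split; rewrite /xi3 /qscaler /qmul /qk !mxE /= ?mxE /=; ring. Qed.


Lemma matrix4P a b :
  (forall k, [/\ a k 0 = b k 0, a k 1 = b k 1, a k 2 = b k 2 & a k 3 = b k 3]) -> a = b.
Proof. by move=> ab; apply/matrixP => k; apply: ord4P; have [] := ab k. Qed.

Lemma dot4E a b : dot a b = \sum_k (a k 0 * b k 0 + a k 1 * b k 1 + a k 2 * b k 2 + a k 3 * b k 3).
Proof. by apply: eq_bigr => k _; rewrite sum4. Qed.

Lemma mx_linE n (r : R) (a b : 'M[R]_(m, n)) k l : (r *: a + b) k l = r * a k l + b k l.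
Proof. by rewrite !mxE. Qed.

Lemma mx_oppE n (a : 'M[R]_(m, n)) k l : (- a) k l = - a k l.
Proof. by rewrite mxE. Qed.

Lemma xi1_linear : linear (@xi1 R m).
Proof.
move=> r a b; apply: matrix4P => k; rewrite !mx_linE.
by have [-> -> -> ->] := xi1E (r *: a + b) k; have [-> -> -> ->] := xi1E a k;
   have [-> -> -> ->] := xi1E b k; rewrite !mx_linE; split; ring.
Qed.

Lemma xi2_linear : linear (@xi2 R m).
Proof.
move=> r a b; apply: matrix4P => k; rewrite !mx_linE.
by have [-> -> -> ->] := xi2E (r *: a + b) k; have [-> -> -> ->] := xi2E a k;
   have [-> -> -> ->] := xi2E b k; rewrite !mx_linE; split; ring.
Qed.

Lemma xi3_linear : linear (@xi3 R m).
Proof.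
move=> r a b; apply: matrix4P => k; rewrite !mx_linE.
by have [-> -> -> ->] := xi3E (r *: a + b) k; have [-> -> -> ->] := xi3E a k;
   have [-> -> -> ->] := xi3E b k; rewrite !mx_linE; split; ring.
Qed.

HB.instance Definition _ := GRing.isLinear.Build R 'M[R]_(m, 4) 'M[R]_(m, 4) _ (@xi1 R m) xi1_linear.
HB.instance Definition _ := GRing.isLinear.Build R 'M[R]_(m, 4) 'M[R]_(m, 4) _ (@xi2 R m) xi2_linear.
HB.instance Definition _ := GRing.isLinear.Build R 'M[R]_(m, 4) 'M[R]_(m, 4) _ (@xi3 R m) xi3_linear.

Lemma xi11 a : xi1 (xi1 a) = - a.
Proof.
apply: matrix4P => k; rewrite !mx_oppE.
by have [-> -> -> ->] := xi1E (xi1 a) k; have [-> -> -> ->] := xi1E a k; rewrite ?opprK.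
Qed.

(** Right multiplications compose in reverse order: this is a j i = - a k. *)
Lemma xi12 a : xi1 (xi2 a) = - xi3 a.
Proof.
apply: matrix4P => k; rewrite !mx_oppE.
have [-> -> -> ->] := xi1E (xi2 a) k; have [-> -> -> ->] := xi2E a k.
by have [-> -> -> ->] := xi3E a k; rewrite ?opprK.
Qed.

Lemma xi13 a : xi1 (xi3 a) = xi2 a.
Proof.
apply: matrix4P => k.
have [-> -> -> ->] := xi1E (xi3 a) k; have [-> -> -> ->] := xi3E a k.
by have [-> -> -> ->] := xi2E a k; rewrite ?opprK.
Qed.

Lemma xi21 a : xi2 (xi1 a) = xi3 a.
Proof.
apply: matrix4P => k.
have [-> -> -> ->] := xi2E (xi1 a) k; have [-> -> -> ->] := xi1E a k.
by have [-> -> -> ->] := xi3E a k; rewrite ?opprK.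
Qed.

Lemma xi22 a : xi2 (xi2 a) = - a.
Proof.
apply: matrix4P => k; rewrite !mx_oppE.
by have [-> -> -> ->] := xi2E (xi2 a) k; have [-> -> -> ->] := xi2E a k; rewrite ?opprK.
Qed.

Lemma xi23 a : xi2 (xi3 a) = - xi1 a.
Proof.
apply: matrix4P => k; rewrite !mx_oppE.
have [-> -> -> ->] := xi2E (xi3 a) k; have [-> -> -> ->] := xi3E a k.
by have [-> -> -> ->] := xi1E a k; rewrite ?opprK.
Qed.

Lemma xi31 a : xi3 (xi1 a) = - xi2 a.
Proof.
apply: matrix4P => k; rewrite !mx_oppE.
have [-> -> -> ->] := xi3E (xi1 a) k; have [-> -> -> ->] := xi1E a k.
by have [-> -> -> ->] := xi2E a k; rewrite ?opprK.
Qed.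

Lemma xi33 a : xi3 (xi3 a) = - a.
Proof.
apply: matrix4P => k; rewrite !mx_oppE.
by have [-> -> -> ->] := xi3E (xi3 a) k; have [-> -> -> ->] := xi3E a k; rewrite ?opprK.
Qed.

Lemma dot_xi1l a b : dot (xi1 a) b = - dot a (xi1 b).
Proof.
rewrite !dot4E -sumrN; apply: eq_bigr => k _.
by have [-> -> -> ->] := xi1E a k; have [-> -> -> ->] := xi1E b k; ring.
Qed.

Lemma dot_xi2l a b : dot (xi2 a) b = - dot a (xi2 b).
Proof.
rewrite !dot4E -sumrN; apply: eq_bigr => k _.
by have [-> -> -> ->] := xi2E a k; have [-> -> -> ->] := xi2E b k; ring.
Qed.

Lemma dot_xi3l a b : dot (xi3 a) b = - dot a (xi3 b).
Proof.
rewrite !dot4E -sumrN; apply: eq_bigr => k _.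
by have [-> -> -> ->] := xi3E a k; have [-> -> -> ->] := xi3E b k; ring.
Qed.

End QuaternionicStructure.

Lemma qmul_qi {R : realType} (z : 'rV[R]_4) : qmul z qi = xi1 z.
Proof.
apply/rowP => l; rewrite [RHS]mxE; congr (qmul _ _ _ _).
by apply/rowP => k; rewrite mxE.
Qed.

#[local] Opaque xi1 xi2 xi3 dot.

(** * Smoothness of brackets on the ambient product space *)

Section Ambient.
Context {R : realType} {m : nat}.
Notation E := (@ambient R m).
Implicit Types (X Y : E -> E) (x y v : E).

Section Components.
Variables (U : normedModType R) (f : U -> E).

Lemma smooth_comp1 : smooth f -> smooth (fun y : U => (f y).1).
Proof. exact: (@smooth_fst _ U 'M[R]_(m, 4) 'rV[R]_4 f). Qed.

Lemma smooth_comp2 : smooth f -> smooth (fun y : U => (f y).2).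
Proof. exact: (@smooth_snd _ U 'M[R]_(m, 4) 'rV[R]_4 f). Qed.

Lemma differentiable_comp1 (x : U) : differentiable f x -> differentiable (fun y : U => (f y).1) x.
Proof. exact: (@differentiable_fst _ U 'M[R]_(m, 4) 'rV[R]_4 f). Qed.

Lemma differentiable_comp2 (x : U) : differentiable f x -> differentiable (fun y : U => (f y).2) x.
Proof. exact: (@differentiable_snd _ U 'M[R]_(m, 4) 'rV[R]_4 f). Qed.

Lemma derive_comp1 (x v : U) : differentiable f x -> 'D_v (fun y : U => (f y).1) x = ('D_v f x).1.
Proof. exact: (@derive_fst _ U 'M[R]_(m, 4) 'rV[R]_4 f). Qed.

Lemma derive_comp2 (x v : U) : differentiable f x -> 'D_v (fun y : U => (f y).2) x = ('D_v f x).2.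
Proof. exact: (@derive_snd _ U 'M[R]_(m, 4) 'rV[R]_4 f). Qed.

End Components.

Lemma ambient_basis v : v =
  \sum_(k < m) \sum_(l < 4) dot v.1 (delta_mx k l) *: ((delta_mx k l, 0) : E) +
  \sum_(k < 1) \sum_(l < 4) dot v.2 (delta_mx k l) *: ((0, delta_mx k l) : E).
Proof.
have inl_linear : linear (fun a : 'M[R]_(m, 4) => (a, 0) : E).
  by move=> r a b; congr (_, _); rewrite /= scaler0 addr0.
have inr_linear : linear (fun a : 'rV[R]_4 => (0, a) : E).
  by move=> r a b; congr (_, _); rewrite /= scaler0 addr0.
pose inlM := GRing.isLinear.Build _ _ _ _ _ inl_linear.
pose inlL : {linear _ -> E} := HB.pack (fun a : 'M[R]_(m, 4) => (a, 0) : E) inlM.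
pose inrM := GRing.isLinear.Build _ _ _ _ _ inr_linear.
pose inrL : {linear _ -> E} := HB.pack (fun a : 'rV[R]_4 => (0, a) : E) inrM.
have -> : v = inlL v.1 + inrL v.2 by case: v => a b; congr (_, _); rewrite /= ?addr0 ?add0r.
rewrite {1}(matrix_sum_delta v.1) {1}(matrix_sum_delta v.2) !linear_sum.
congr (_ + _); apply: eq_bigr => k _; rewrite linear_sum; apply: eq_bigr => l _;
  by rewrite linearZ/= dot_delta ?addr0 ?add0r.
Qed.

(** The direction varies with the point, so it is expanded in a basis: smooth coefficients times
    derivatives in fixed directions. *)
Lemma smooth_derive_along X Y : smooth X -> smooth Y -> smooth (fun x => 'D_(X x) Y x).
Proof.
move=> sX sY.
have sD v : smooth (fun x => 'D_v Y x) by move=> n; have /CkS[_] := sY n.+1; exact.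
rewrite (_ : (fun x => _) = fun x =>
  \sum_(k < m) \sum_(l < 4) dot (X x).1 (delta_mx k l) *: 'D_((delta_mx k l, 0) : E) Y x +
  \sum_(k < 1) \sum_(l < 4) dot (X x).2 (delta_mx k l) *: 'D_((0, delta_mx k l) : E) Y x).
  apply: smoothD; apply: smooth_sum => k; apply: smooth_sum => l; apply: smoothZ => //;
    by apply: smooth_dot; [(exact: smooth_comp1 || exact: smooth_comp2)|exact: smooth_cst].
apply/funext => x; have dY : differentiable Y x by exact: smooth_differentiable.
rewrite deriveE// {1}(ambient_basis (X x)) linearD !linear_sum/=.
congr (_ + _); apply: eq_bigr => k _; rewrite linear_sum; apply: eq_bigr => l _;
  by rewrite linearZ/= deriveE.
Qed.

Lemma smooth_lie_bracket X Y : smooth X -> smooth Y -> smooth (lie_bracket X Y).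
Proof.
move=> sX sY; rewrite (_ : lie_bracket X Y = fun x => 'D_(X x) Y x + (-1) *: 'D_(Y x) X x).
  apply: smoothD; first exact: smooth_derive_along.
  by apply: smoothZ; [exact: smooth_cst|exact: smooth_derive_along].
by apply/funext => x; rewrite scaleN1r.
Qed.

End Ambient.

Section CircularCurve.
Context {R : realType}.
Implicit Types (w t : R).

Lemma is_derive_cosM w t : is_derive t (1 : R) (fun s => cos (w * s)) (- sin (w * t) * w).
Proof.
have idw : is_derive t (1 : R) ( *%R w : R -> R) w.
  by apply: is_derive_eq; rewrite [_ *: _]mulr1.
exact: (is_derive1_comp (f := cos)).
Qed.

Lemma is_derive_sinM w t : is_derive t (1 : R) (fun s => sin (w * s)) (cos (w * t) * w).
Proof.
have idw : is_derive t (1 : R) ( *%R w : R -> R) w.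
  by apply: is_derive_eq; rewrite [_ *: _]mulr1.
exact: (is_derive1_comp (f := sin)).
Qed.

Lemma differentiable_cosM w t : differentiable (fun s => cos (w * s)) t.
Proof. by apply/derivable1_diffP; have [] := is_derive_cosM w t. Qed.

Lemma differentiable_sinM w t : differentiable (fun s => sin (w * s)) t.
Proof. by apply/derivable1_diffP; have [] := is_derive_sinM w t. Qed.

Context {W : normedModType R}.
Implicit Types (a b : W).

(** One family serves three purposes: curves realizing tangent vectors, integral curves of [TP], and
    a curve crossing the leaves. It is closed under differentiation, so smoothness follows by
    induction over all [a] and [b]. *)
Definition circular w a b (t : R) : W := cos (w * t) *: a + sin (w * t) *: b.

Lemma circular0 w a b : circular w a b 0 = a.
Proof. by rewrite /circular mulr0 cos0 sin0 scale1r scale0r addr0. Qed.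

Lemma circularZ w k a b t : k *: circular w a b t = circular w (k *: a) (k *: b) t.
Proof. by rewrite /circular scalerDr !scalerA !(mulrC k). Qed.

Global Instance is_derive_circular w a b (t : R) :
  is_derive t (1 : R) (circular w a b) (w *: circular w b (- a) t).
Proof.
have [dc Dc] := is_derive_cosM w t; have [ds Ds] := is_derive_sinM w t.
have dfc := differentiable_cosM w t; have dfs := differentiable_sinM w t.
have dca (c : W) : differentiable (fun s => cos (w * s) *: c) t.
  by apply: differentiable_scale => //; exact: differentiable_cst.
have dsa (c : W) : differentiable (fun s => sin (w * s) *: c) t.
  by apply: differentiable_scale => //; exact: differentiable_cst.
apply: DeriveDef; first exact/diff_derivable/differentiableD.
rewrite deriveD; [|exact: diff_derivable..].
rewrite !derive_scale//; try exact: differentiable_cst.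
rewrite !derive_cst !scaler0 !addr0 Dc Ds circularZ /circular.
by rewrite !scalerA addrC scalerN -scaleNr mulNr.
Qed.

Lemma smooth_circular w a b : smooth (circular w a b).
Proof.
move=> n; elim: n a b => [|n IH] a b.
  by move=> t _; apply: differentiable_continuous; apply/derivable1_diffP.
split=> [t _|v]; first exact/derivable1_diffP.
rewrite (_ : (fun t => _) = circular w ((v * w) *: b) ((v * w) *: (- a))); first exact: IH.
apply/funext => t.
have dt : differentiable (circular w a b) t by apply/derivable1_diffP.
by rewrite deriveE// -[v]mulr1 [_ * 1]/(v *: 1) linearZ/= -deriveE// derive_val !scalerA mulr1 circularZ.
Qed.

Lemma derive1_circular w a b t : derive1 (circular w a b) t = w *: circular w b (- a) t.
Proof. by rewrite derive1E derive_val. Qed.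

End CircularCurve.

(** * The manifold *)

Section Tangent.
Context {R : realType} {m : nat}.
Notation E := (@ambient R m).
Notation P := (@Pm R m).
Implicit Types (x y v a b : E) (X Y : E -> E).

Lemma dot_xi1_self k (a : 'M[R]_(k, 4)) : dot (xi1 a) a = 0.
Proof. by have := dot_xi1l a a; rewrite [dot a (xi1 a)]dotC; lra. Qed.

Lemma dot_xi2_self k (a : 'M[R]_(k, 4)) : dot (xi2 a) a = 0.
Proof. by have := dot_xi2l a a; rewrite [dot a (xi2 a)]dotC; lra. Qed.

Lemma dot_xi3_self k (a : 'M[R]_(k, 4)) : dot (xi3 a) a = 0.
Proof. by have := dot_xi3l a a; rewrite [dot a (xi3 a)]dotC; lra. Qed.

Lemma dot_row4 (a b : 'rV[R]_4) :
  dot a b = a 0 0 * b 0 0 + a 0 1 * b 0 1 + a 0 2 * b 0 2 + a 0 3 * b 0 3.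
Proof. by rewrite dot4E big_ord1. Qed.

Lemma circle_dot (z : 'rV[R]_4) : circle_i z -> dot z z = 1.
Proof. by move=> [z1 [z2 z3]]; rewrite dot_row4 z2 z3 -z1; ring. Qed.

Lemma Pm_dot1 x : P x -> dot x.1 x.1 = 1. Proof. by case. Qed.
Lemma Pm_dot2 x : P x -> dot x.2 x.2 = 1. Proof. by case=> _ /circle_dot. Qed.

Lemma derive1_dot_const n k (c : R -> 'M[R]_(n, k)) (r t : R) : differentiable c t ->
  (forall s, dot (c s) (c s) = r) -> dot (c t) (derive1 c t) = 0.
Proof.
move=> dc cc; have : 'D_1 (fun s => dot (c s) (c s)) t = 0.
  by under eq_fun do rewrite cc; rewrite derive_cst.
by rewrite derive_dot// -derive1E [dot (derive1 c t) _]dotC; lra.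
Qed.

Lemma circularE n k w (a b : 'M[R]_(n, k)) t i j :
  circular w a b t i j = cos (w * t) * a i j + sin (w * t) * b i j.
Proof. by rewrite !mxE. Qed.

(** Differentiating the defining equations along a curve gives one direction; conversely a great
    circle in the sphere and a rotation of the circle factor realize the vector. *)
Lemma tangent_PmP x v : P x ->
  tangent P x v <-> dot x.1 v.1 = 0 /\ v.2 = dot (xi1 x.2) v.2 *: xi1 x.2.
Proof.
move=> Px; split=> [[c [sc Pc c0 cv]]|[v1 v2]].
  have dc := smooth_differentiable 0 sc.
  have d1 := differentiable_comp1 dc; have d2 := differentiable_comp2 dc.
  have c1 : derive1 (fun s => (c s).1) 0 = v.1 by rewrite derive1E derive_comp1// -derive1E cv.
  have c2 : derive1 (fun s => (c s).2) 0 = v.2 by rewrite derive1E derive_comp2// -derive1E cv.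
  have xv2 : dot x.2 v.2 = 0.
    rewrite -c2 -{1}c0; apply: (derive1_dot_const (c := fun s => (c s).2) (r := 1)) => // s.
    exact: Pm_dot2.
  split.
    rewrite -c1 -{1}c0; apply: (derive1_dot_const (c := fun s => (c s).1) (r := 1)) => // s.
    exact: Pm_dot1.
  have coord l : (forall s, (c s).2 0 l = 0) -> v.2 0 l = 0.
    move=> cl; have : 'D_1 (fun s => dot (c s).2 (delta_mx 0 l)) 0 = 0 :> R.
      by under eq_fun do rewrite dot_delta cl; rewrite derive_cst.
    rewrite derive_dot//.
    by rewrite derive_cst dot0r addr0 dot_delta -derive1E c2.
  have v02 : v.2 0 2 = 0 by apply: coord => s; have [_ [_ []]] := Pc s.
  have v03 : v.2 0 3 = 0 by apply: coord => s; have [_ [_ []]] := Pc s.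
  have [_ [z1 [z2 z3]]] := Px.
  move: xv2; rewrite !dot_row4; have [-> -> -> ->] := xi1E x.2 0; rewrite z2 z3 v02 v03 => xv2.
  apply: matrix4P => k; rewrite ord1; split; rewrite mxE.
  - have [-> _ _ _] := xi1E x.2 0.
    (* The sum of squares is 1, and the final 0 is about to be replaced by the vanishing product of
       [x.2] and [v.2], leaving a polynomial identity. *)
    transitivity ((x.2 0 0 ^+ 2 + x.2 0 1 ^+ 2) * v.2 0 0 - x.2 0 0 * 0); first by rewrite z1; ring.
    by rewrite -xv2; ring.
  - have [_ -> _ _] := xi1E x.2 0.
    transitivity ((x.2 0 0 ^+ 2 + x.2 0 1 ^+ 2) * v.2 0 1 - x.2 0 1 * 0); first by rewrite z1; ring.
    by rewrite -xv2; ring.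
  - by have [_ _ -> _] := xi1E x.2 0; rewrite z3 mulr0.
  - by have [_ _ _ ->] := xi1E x.2 0; rewrite z2 oppr0 mulr0.
(* If [v.1] is 0, then [w] and its inverse are 0, so [u] is 0 and the circular curve of frequency 0
   is constant. *)
pose w := Num.sqrt (dot v.1 v.1); pose t := dot (xi1 x.2) v.2.
pose u := w^-1 *: v.1.
have wv : w *: u = v.1.
  have [w0|w0] := eqVneq w 0; last by rewrite scalerA divff// scale1r.
  rewrite w0 scale0r; apply/esym/dot_eq0.
  by move: w0 => /eqP; rewrite sqrtr_eq0 => h; apply: le_anti; rewrite h dot_ge0.
have uu : w != 0 -> dot u u = 1.
  move=> w0; rewrite /u dotZl dotZr -[dot v.1 v.1]sqr_sqrtr ?dot_ge0// -/w.
  by field.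
have xu : dot x.1 u = 0 by rewrite dotZr v1 mulr0.
clearbody u; have P1 := Pm_dot1 Px.
exists (fun s => (circular w x.1 u s, circular t x.2 (xi1 x.2) s)); split.
- by apply: smooth_pair; exact: smooth_circular.
- move=> s; split; rewrite /qsphere /circle_i /=.
    rewrite /circular dotDl !dotDr !dotZl !dotZr P1 xu [dot u x.1]dotC xu.
    have [w0|w0] := eqVneq w 0.
      by rewrite w0 mul0r sin0 cos0; ring.
    by rewrite uu// -[RHS](cos2Dsin2 (w * s)); ring.
  have [_ [z1 [z2 z3]]] := Px; rewrite !circularE.
  have [-> -> -> ->] := xi1E x.2 0; rewrite z2 z3; split; last by split; ring.
  transitivity ((cos (t * s) ^+ 2 + sin (t * s) ^+ 2) * (x.2 0 0 ^+ 2 + x.2 0 1 ^+ 2)); first by ring.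
  by rewrite cos2Dsin2 z1 mul1r.
- by rewrite !circular0; case: (x).
- have d1 := smooth_differentiable 0 (smooth_circular w x.1 u).
  have d2 := smooth_differentiable 0 (smooth_circular t x.2 (xi1 x.2)).
  rewrite derive1E (derive_pair (1 : R) d1 d2) -!derive1E !derive1_circular !circular0 wv -v2.
  by case: (v).
Qed.

Lemma tangent_Pm_linear x k a b : P x -> tangent P x a -> tangent P x b ->
  tangent P x (k *: a + b).
Proof.
move=> Px /tangent_PmP-/(_ Px)[a1 a2] /tangent_PmP-/(_ Px)[b1 b2]; apply/tangent_PmP => //.
split=> /=; first by rewrite dotDr dotZr a1 b1 mulr0 addr0.
by rewrite {1}a2 {1}b2 dotDr dotZr scalerDl scalerA.
Qed.

Lemma smooth_xi1 (V : normedModType R) k (f : V -> 'M[R]_(k, 4)) :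
  smooth f -> smooth (fun y : V => xi1 (f y)).
Proof. exact: (@smooth_linear _ _ _ _ (@xi1 R k) (@mx_linear_continuous _ _ _ _ _) f). Qed.

Lemma smooth_xi2 (V : normedModType R) k (f : V -> 'M[R]_(k, 4)) :
  smooth f -> smooth (fun y : V => xi2 (f y)).
Proof. exact: (@smooth_linear _ _ _ _ (@xi2 R k) (@mx_linear_continuous _ _ _ _ _) f). Qed.

Lemma smooth_xi3 (V : normedModType R) k (f : V -> 'M[R]_(k, 4)) :
  smooth f -> smooth (fun y : V => xi3 (f y)).
Proof. exact: (@smooth_linear _ _ _ _ (@xi3 R k) (@mx_linear_continuous _ _ _ _ _) f). Qed.

Lemma derive_xi1 (V : normedModType R) k (f : V -> 'M[R]_(k, 4)) (x v : V) :
  differentiable f x -> 'D_v (fun y : V => xi1 (f y)) x = xi1 ('D_v f x).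
Proof. exact: (@derive_linear _ _ _ _ (@xi1 R k) (@mx_linear_continuous _ _ _ _ _) f). Qed.

Lemma derive_xi2 (V : normedModType R) k (f : V -> 'M[R]_(k, 4)) (x v : V) :
  differentiable f x -> 'D_v (fun y : V => xi2 (f y)) x = xi2 ('D_v f x).
Proof. exact: (@derive_linear _ _ _ _ (@xi2 R k) (@mx_linear_continuous _ _ _ _ _) f). Qed.

Lemma derive_xi3 (V : normedModType R) k (f : V -> 'M[R]_(k, 4)) (x v : V) :
  differentiable f x -> 'D_v (fun y : V => xi3 (f y)) x = xi3 ('D_v f x).
Proof. exact: (@derive_linear _ _ _ _ (@xi3 R k) (@mx_linear_continuous _ _ _ _ _) f). Qed.

(** Connections act on fields, so a single test vector must be extended: project the constant field
    [v.1] onto the tangent spaces of the sphere and rotate along the circle. *)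
Lemma vector_field_extension x v : P x -> tangent P x v ->
  exists2 Z, vector_field P Z & Z x = v.
Proof.
move=> Px /tangent_PmP-/(_ Px)[v1 v2].
pose Z y : E := (v.1 + - dot y.1 v.1 *: y.1, dot (xi1 x.2) v.2 *: xi1 y.2).
have s1 := smooth_comp1 (@smooth_id _ E); have s2 := smooth_comp2 (@smooth_id _ E).
exists Z; last by rewrite /Z v1 oppr0 scale0r addr0 -v2; case: (v).
split.
  apply: smooth_pair.
    apply: smoothD; first exact: smooth_cst.
    apply: smoothZ => //; rewrite (_ : (fun y => _) = fun y : E => dot y.1 (- v.1)).
      by apply: smooth_dot => //; exact: smooth_cst.
    by apply/funext => y; rewrite dotNr.
  by apply: smoothZ; [exact: smooth_cst|exact: smooth_xi1].
move=> y Py; apply/tangent_PmP => //=; split.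
  by rewrite dotDr dotZr (Pm_dot1 Py) mulr1 subrr.
rewrite dotZr; suff -> : dot (xi1 y.2) (xi1 y.2) = 1 by rewrite mulr1.
by rewrite dot_xi1l xi11 dotNr opprK Pm_dot2.
Qed.

End Tangent.

Section DirectionalDerivative.
Context {R : realType} {V : normedModType R}.
Variables x v : V.

(** Differentiability travels with the value, so the derivative of a long expression is assembled as
    one term. *)
Definition der (f : V -> R) (df : R) : Prop := differentiable f x /\ 'D_v f x = df.

Lemma derD f g df dg : der f df -> der g dg -> der (fun y => f y + g y) (df + dg).
Proof.
move=> [f1 <-] [g1 <-]; split; first exact: differentiableD.
by rewrite deriveD//; exact: diff_derivable.
Qed.

Lemma derM f g df dg : der f df -> der g dg -> der (fun y => f y * g y) (df * g x + f x * dg).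
Proof.
move=> [f1 <-] [g1 <-]; split; first exact: differentiable_scale.
exact: derive_scale.
Qed.

Lemma derZ k f df : der f df -> der (fun y => k * f y) (k * df).
Proof.
move=> [f1 <-]; split; first exact: (differentiable_scale (k := fun=> k)).
by rewrite (derive_scale (k := fun=> k))// derive_cst scale0r add0r.
Qed.

End DirectionalDerivative.

Section Forms.
Context {R : realType} {m : nat}.
Implicit Types (y a : @ambient R m).

(* These are bilinear in both arguments: [eta1 v a] with [v] a tangent vector is half
   of the exterior derivative of [eta1] on [v, a]. *)
Definition eta1 y a : R := dot (xi1 y.1) a.1.
Definition eta2 y a : R := dot (xi2 y.1) a.1.
Definition eta3 y a : R := dot (xi3 y.1) a.1.
Definition sigma_form (D : R) y a : R := 2 / D * dot (xi1 y.2) a.2.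

End Forms.

(** Turns form values into atoms for [ring] and [field]. Relations between the values are lost, so
    they must be rewritten beforehand. *)
Ltac generalize_forms := repeat match goal with
  | |- context [eta1 ?y ?a] => generalize (eta1 y a); intro
  | |- context [eta2 ?y ?a] => generalize (eta2 y a); intro
  | |- context [eta3 ?y ?a] => generalize (eta3 y a); intro
  | |- context [sigma_form ?D ?y ?a] => generalize (sigma_form D y a); intro
  | |- context [dot ?a ?b] => generalize (dot a b); intro
  end.

(** * The metric *)

Section Metric.
Context {R : realType} {m : nat}.
Variables A C D p q : R.
Notation E := (@ambient R m).
Notation P := (@Pm R m).
Local Notation sg := (sigma_form D).
Notation g := (@gP R m A C D p q).
Implicit Types (x y v a b c : E) (X Y Z : E -> E).

Definition leaf_speed : R := Num.sqrt (A * C) / 2.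
Local Notation lam := leaf_speed.
(** This is M^2 - L^2, since L = 1 / [leaf_speed]; it equals 4 (C - A) / (A^2 C), hence is negative
    for C < A. *)
Definition xi2_defect : R := (2 / A) ^+ 2 - lam^-1 ^+ 2.
Local Notation kap := xi2_defect.

Hypotheses (hC : 0 < C) (hAC : C < A) (hD : 0 < D).

Lemma A_gt0 : 0 < A. Proof. exact: lt_trans hC hAC. Qed.

Lemma lam_gt0 : 0 < lam.
Proof. by rewrite divr_gt0// sqrtr_gt0 mulr_gt0// A_gt0. Qed.

Lemma lam_sqr : lam ^+ 2 = A * C / 4.
Proof.
rewrite expr_div_n sqr_sqrtr; last by rewrite mulr_ge0 ?ltW// A_gt0.
by congr (_ / _); rewrite -natrX.
Qed.

(** The forms on the right are bilinear in base point and vector, so differentiating the metric in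
    its base point yields the same forms again. The correction along xi_2 drops out of [beta1] and
    [beta3] because xi_1, xi_3 are orthogonal to xi_2. *)
Lemma gPE y a b : g y a b =
  lam^-1 ^+ 2 * dot a.1 b.1 + kap * (eta2 y a * eta2 y b) + sg y a * sg y b
  + p / lam * (eta1 y a * sg y b + sg y a * eta1 y b)
  + q / lam * (eta3 y a * sg y b + sg y a * eta3 y b).
Proof.
have A0 := lt0r_neq0 A_gt0; have lam0 := lt0r_neq0 lam_gt0; have D0 := lt0r_neq0 hD.
have -> : g y a b = gAC A C y.1 a.1 b.1 + sg y a * sg y b
  + p * (beta1 A C y.1 a.1 * sg y b + sg y a * beta1 A C y.1 b.1)
  + q * (beta3 A C y.1 a.1 * sg y b + sg y a * beta3 A C y.1 b.1).
  have sgE c : sigma D y.2 c.2 = sg y c.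
    by rewrite /sigma /gS3 /v1 qmul_qi dotZl /sigma_form; field.
  by rewrite /gP !sgE.
have lamV : 2 / Num.sqrt (A * C) = lam^-1 by rewrite /leaf_speed invf_div.
have b1 c : beta1 A C y.1 c.1 = eta1 y c / lam.
  rewrite /beta1 /gAC /u1 lamV -/lam dotZl dotZr.
  have -> : dot (xi2 y.1) (xi1 y.1) = 0.
    by rewrite dot_xi2l xi21 dotC dot_xi3_self oppr0.
  by rewrite /eta1; field; rewrite A0 lam0.
have b3 c : beta3 A C y.1 c.1 = eta3 y c / lam.
  rewrite /beta3 /gAC /u3 lamV -/lam dotZl dotZr.
  have -> : dot (xi2 y.1) (xi3 y.1) = 0.
    by rewrite dot_xi2l xi23 dotNr opprK dotC dot_xi1_self.
  by rewrite /eta3; field; rewrite A0 lam0.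
rewrite !b1 !b3 /gAC lamV -/(eta2 y a) -/(eta2 y b) /xi2_defect.
by field; rewrite A0 lam0.
Qed.

Lemma gP_sym y a b : g y a b = g y b a.
Proof. by rewrite !gPE (dotC b.1); ring. Qed.

Lemma eta1_linear k y a b : eta1 y (k *: a + b) = k * eta1 y a + eta1 y b.
Proof. by rewrite /eta1 /= dotDr dotZr. Qed.

Lemma eta2_linear k y a b : eta2 y (k *: a + b) = k * eta2 y a + eta2 y b.
Proof. by rewrite /eta2 /= dotDr dotZr. Qed.

Lemma eta3_linear k y a b : eta3 y (k *: a + b) = k * eta3 y a + eta3 y b.
Proof. by rewrite /eta3 /= dotDr dotZr. Qed.

Lemma sigma_form_linear k y a b : sg y (k *: a + b) = k * sg y a + sg y b.
Proof. by rewrite /sigma_form /= dotDr dotZr; ring. Qed.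

Lemma gP_linear y k a b c : g y (k *: a + b) c = k * g y a c + g y b c.
Proof.
by rewrite !gPE eta1_linear eta2_linear eta3_linear sigma_form_linear /= dotDl dotZl; ring.
Qed.

Section SmoothForms.
Variable X : E -> E.
Hypothesis sX : smooth X.

Let s1 := smooth_comp1 (@smooth_id _ E).
Let s2 := smooth_comp2 (@smooth_id _ E).

Lemma smooth_eta1 : smooth (fun y => eta1 y (X y)).
Proof. by apply: smooth_dot; [exact: smooth_xi1|exact: smooth_comp1]. Qed.

Lemma smooth_eta2 : smooth (fun y => eta2 y (X y)).
Proof. by apply: smooth_dot; [exact: smooth_xi2|exact: smooth_comp1]. Qed.

Lemma smooth_eta3 : smooth (fun y => eta3 y (X y)).
Proof. by apply: smooth_dot; [exact: smooth_xi3|exact: smooth_comp1]. Qed.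

Lemma smooth_sigma_form : smooth (fun y => sg y (X y)).
Proof.
apply: smoothM; first exact: smooth_cst.
by apply: smooth_dot; [exact: smooth_xi1|exact: smooth_comp2].
Qed.

Variables x v : E.
Let dX := smooth_differentiable x sX.

Lemma der_eta1 : der x v (fun y => eta1 y (X y)) (eta1 v (X x) + eta1 x ('D_v X x)).
Proof.
split; first exact: smooth_differentiable smooth_eta1.
rewrite derive_dot; last 2 first.
- exact/smooth_differentiable/smooth_xi1.
- exact: differentiable_comp1.
rewrite derive_xi1 ?derive_comp1 ?derive_id//; exact: smooth_differentiable.
Qed.

Lemma der_eta2 : der x v (fun y => eta2 y (X y)) (eta2 v (X x) + eta2 x ('D_v X x)).
Proof.
split; first exact: smooth_differentiable smooth_eta2.
rewrite derive_dot; last 2 first.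
- exact/smooth_differentiable/smooth_xi2.
- exact: differentiable_comp1.
rewrite derive_xi2 ?derive_comp1 ?derive_id//; exact: smooth_differentiable.
Qed.

Lemma der_eta3 : der x v (fun y => eta3 y (X y)) (eta3 v (X x) + eta3 x ('D_v X x)).
Proof.
split; first exact: smooth_differentiable smooth_eta3.
rewrite derive_dot; last 2 first.
- exact/smooth_differentiable/smooth_xi3.
- exact: differentiable_comp1.
rewrite derive_xi3 ?derive_comp1 ?derive_id//; exact: smooth_differentiable.
Qed.

Lemma der_sigma_form : der x v (fun y => sg y (X y)) (sg v (X x) + sg x ('D_v X x)).
Proof.
rewrite /sigma_form -mulrDr; apply: derZ; split.
  by apply/smooth_differentiable/smooth_dot; [exact: smooth_xi1|exact: smooth_comp2].
rewrite derive_dot; last 2 first.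
- exact/smooth_differentiable/smooth_xi1.
- exact: differentiable_comp2.
rewrite derive_xi1 ?derive_comp2 ?derive_id//; exact: smooth_differentiable.
Qed.

End SmoothForms.

Lemma der_dot X Y x v : smooth X -> smooth Y ->
  der x v (fun y => dot (X y).1 (Y y).1) (dot ('D_v X x).1 (Y x).1 + dot (X x).1 ('D_v Y x).1).
Proof.
move=> sX sY; split.
  by apply/smooth_differentiable/smooth_dot; exact: smooth_comp1.
have dX := smooth_differentiable x sX; have dY := smooth_differentiable x sY.
rewrite derive_dot; [|exact: differentiable_comp1..].
by rewrite !derive_comp1.
Qed.

(* The derivative of [gP] along [v] in its base point only. *)
Definition dgP v y a b : R :=
  kap * (eta2 v a * eta2 y b + eta2 y a * eta2 v b) + (sg v a * sg y b + sg y a * sg v b)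
  + p / lam * (eta1 v a * sg y b + eta1 y a * sg v b + (sg v a * eta1 y b + sg y a * eta1 v b))
  + q / lam * (eta3 v a * sg y b + eta3 y a * sg v b + (sg v a * eta3 y b + sg y a * eta3 v b)).

Lemma derive_gP X Y x v : smooth X -> smooth Y ->
  'D_v (fun y => g y (X y) (Y y)) x =
    dgP v x (X x) (Y x) + g x ('D_v X x) (Y x) + g x (X x) ('D_v Y x).
Proof.
move=> sX sY; under eq_fun do rewrite gPE.
have [[e1 e2] e3] := (der_eta1 sX x v, der_eta2 sX x v, der_eta3 sX x v).
have [[f1 f2] f3] := (der_eta1 sY x v, der_eta2 sY x v, der_eta3 sY x v).
have [s t] := (der_sigma_form sX x v, der_sigma_form sY x v).
have ab := derD (derM e1 t) (derM s f1); have cd := derD (derM e3 t) (derM s f3).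
have [_ ->] := derD (derD (derD (derD (derZ (lam^-1 ^+ 2) (der_dot x v sX sY))
  (derZ kap (derM e2 f2))) (derM s t)) (derZ (p / lam) ab)) (derZ (q / lam) cd).
by rewrite !gPE /dgP; generalize_forms; ring.
Qed.

Lemma smooth_gP X Y : smooth X -> smooth Y -> smooth (fun y => g y (X y) (Y y)).
Proof.
move=> sX sY; under eq_fun do rewrite gPE.
have cM k (f : E -> R) : smooth f -> smooth (fun y => k * f y).
  by apply: smoothM; exact: smooth_cst.
have [[e1 e2] e3] := (smooth_eta1 sX, smooth_eta2 sX, smooth_eta3 sX).
have [[f1 f2] f3] := (smooth_eta1 sY, smooth_eta2 sY, smooth_eta3 sY).
have [s t] := (smooth_sigma_form sX, smooth_sigma_form sY).
have sd := smooth_dot (smooth_comp1 sX) (smooth_comp1 sY).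
exact: (smoothD (smoothD (smoothD (smoothD (cM _ _ sd) (cM _ _ (smoothM e2 f2))) (smoothM s t))
  (cM _ _ (smoothD (smoothM e1 t) (smoothM s f1)))) (cM _ _ (smoothD (smoothM e3 t) (smoothM s f3)))).
Qed.

End Metric.

(** * Mixed curvature *)

Section Geometry.
Context {R : realType} {m : nat}.
Variables A C D p q : R.
Hypotheses (hC : 0 < C) (hAC : C < A) (hD : 0 < D) (hpq : p ^+ 2 + q ^+ 2 < 1).
Notation E := (@ambient R m).
Notation P := (@Pm R m).
Notation g := (@gP R m A C D p q).
Notation T := (@TP R m A C).
Notation vf := (vector_field P).
Implicit Types (x y v a b c : E) (X Y Z : E -> E).
Local Notation lam := (leaf_speed A C).
Local Notation kap := (xi2_defect A C).
Local Notation sg := (sigma_form D).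

Let A0 : A != 0 := lt0r_neq0 (A_gt0 hC hAC).
Let lam0 : lam != 0 := lt0r_neq0 (lam_gt0 hC hAC).
Let gE := @gPE R m A C D p q hC hAC hD.

(* The component of [a.1] orthogonal to the quaternionic line through [x.1]. *)
Definition horizontal x a : 'M[R]_(m, 4) :=
  a.1 - eta1 x a *: xi1 x.1 - eta2 x a *: xi2 x.1 - eta3 x a *: xi3 x.1.

Section Horizontal.
Variables x a : E.
Hypotheses (Px : P x) (ta : tangent P x a).
Local Notation h := (horizontal x a).

Lemma dot_xi_frame :
  [/\ dot (xi1 x.1) (xi1 x.1) = 1, dot (xi2 x.1) (xi2 x.1) = 1, dot (xi3 x.1) (xi3 x.1) = 1
    & [/\ dot (xi1 x.1) (xi2 x.1) = 0, dot (xi1 x.1) (xi3 x.1) = 0 & dot (xi2 x.1) (xi3 x.1) = 0]].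
Proof.
have x1 := Pm_dot1 Px; split; last split.
- by rewrite dot_xi1l xi11 dotNr opprK.
- by rewrite dot_xi2l xi22 dotNr opprK.
- by rewrite dot_xi3l xi33 dotNr opprK.
- by rewrite dot_xi1l xi12 dotNr opprK dotC dot_xi3_self.
- by rewrite dot_xi1l xi13 dotC dot_xi2_self oppr0.
- by rewrite dot_xi2l xi23 dotNr opprK dotC dot_xi1_self.
Qed.

Lemma horizontal_orthogonal :
  [/\ dot x.1 h = 0, dot (xi1 x.1) h = 0, dot (xi2 x.1) h = 0 & dot (xi3 x.1) h = 0].
Proof.
have [[f11 f22 f33 [f12 f13 f23]] [a1 _]] := (dot_xi_frame, (tangent_PmP _ Px).1 ta).
rewrite /horizontal !dotBr !dotZr -/(eta1 x a) -/(eta2 x a) -/(eta3 x a).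
rewrite [dot (xi2 _) (xi1 _)]dotC [dot (xi3 _) (xi1 _)]dotC [dot (xi3 _) (xi2 _)]dotC.
rewrite f11 f22 f33 f12 f13 f23 a1 !(dotC x.1) dot_xi1_self dot_xi2_self dot_xi3_self.
by split; ring.
Qed.

Lemma dot_horizontal : dot a.1 h = dot h h.
Proof.
have [_ h1 h2 h3] := horizontal_orthogonal.
by rewrite {2}/horizontal !dotBl !dotZl h1 h2 h3; ring.
Qed.

Lemma dot_horizontal_sqr : dot h h = dot a.1 a.1 - eta1 x a ^+ 2 - eta2 x a ^+ 2 - eta3 x a ^+ 2.
Proof.
rewrite -dot_horizontal {1}/horizontal !dotBr !dotZr !(dotC a.1 (_ _)).
by rewrite -/(eta1 x a) -/(eta2 x a) -/(eta3 x a); ring.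
Qed.

Lemma tangent_eq0 : dot h h = 0 -> eta1 x a = 0 -> eta2 x a = 0 -> eta3 x a = 0 ->
  sg x a = 0 -> a = 0.
Proof.
move=> /dot_eq0 h0 e1 e2 e3 s0.
have a1 : a.1 = 0 by rewrite -h0 /horizontal e1 e2 e3 !scale0r !subr0.
have [_ a2] := (tangent_PmP _ Px).1 ta.
have t0 : dot (xi1 x.2) a.2 = 0.
  move/eqP: s0; rewrite mulf_eq0 => /orP[|/eqP //].
  by rewrite mulf_eq0 invr_eq0 (gt_eqF hD) pnatr_eq0.
have {}a2 : a.2 = 0 by rewrite a2 t0 scale0r.
by case: (a) a1 a2 => /= b c -> ->.
Qed.

(** Completing the square in sigma leaves a quadratic form in eta_1, eta_3 whose smallest
    eigenvalue, up to scale, is 1 - (p^2 + q^2); this is the source of the bound on p and q. *)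
Lemma gP_sum_of_squares : g x a a =
  lam^-1 ^+ 2 * dot h h + (2 / A) ^+ 2 * eta2 x a ^+ 2
  + (sg x a + p * (eta1 x a / lam) + q * (eta3 x a / lam)) ^+ 2
  + (1 - (p ^+ 2 + q ^+ 2)) * ((eta1 x a / lam) ^+ 2 + (eta3 x a / lam) ^+ 2)
  + (q * (eta1 x a / lam) - p * (eta3 x a / lam)) ^+ 2.
Proof. by rewrite gE dot_horizontal_sqr /xi2_defect; generalize_forms; field; rewrite A0 lam0. Qed.

Lemma gP_gt0 : a != 0 -> 0 < g x a a.
Proof.
move=> an0; rewrite gP_sum_of_squares lt_neqAle andbC.
have c0 : 0 < 1 - (p ^+ 2 + q ^+ 2) by rewrite subr_gt0.
have t1 : 0 <= lam^-1 ^+ 2 * dot h h by rewrite mulr_ge0 ?sqr_ge0// dot_ge0.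
have t2 : 0 <= (2 / A) ^+ 2 * eta2 x a ^+ 2 by rewrite mulr_ge0 ?sqr_ge0.
set y1 := eta1 x a / lam; set y3 := eta3 x a / lam.
have t3 := sqr_ge0 (sg x a + p * y1 + q * y3).
have t4 : 0 <= (1 - (p ^+ 2 + q ^+ 2)) * (y1 ^+ 2 + y3 ^+ 2).
  by apply: mulr_ge0; [exact: ltW|apply: addr_ge0; exact: sqr_ge0].
have t5 := sqr_ge0 (q * y1 - p * y3).
apply/andP; split; first by do 4?[apply: addr_ge0].
apply/negP => /eqP s0; move/eqP: an0; apply.
have r1 : lam^-1 ^+ 2 * dot h h = 0 by lra.
have r2 : (2 / A) ^+ 2 * eta2 x a ^+ 2 = 0 by lra.
have r3 : (sg x a + p * y1 + q * y3) ^+ 2 = 0 by lra.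
have r4 : (1 - (p ^+ 2 + q ^+ 2)) * (y1 ^+ 2 + y3 ^+ 2) = 0 by lra.
have h0 : dot h h = 0.
  by move/eqP: r1; rewrite mulf_eq0 sqrf_eq0 invr_eq0 (negPf lam0) => /eqP.
have e2 : eta2 x a = 0.
  by move/eqP: r2; rewrite mulf_eq0 !sqrf_eq0 mulf_eq0 invr_eq0 (negPf A0) pnatr_eq0 => /eqP.
have [z1 z3] : y1 = 0 /\ y3 = 0.
  move/eqP: r4; rewrite mulf_eq0 (gt_eqF c0) paddr_eq0 ?sqr_ge0//= !sqrf_eq0.
  by move=> /andP[/eqP ? /eqP ?].
have e1 : eta1 x a = 0 by move/eqP: z1; rewrite mulf_eq0 invr_eq0 (negPf lam0) orbF => /eqP.
have e3 : eta3 x a = 0 by move/eqP: z3; rewrite mulf_eq0 invr_eq0 (negPf lam0) orbF => /eqP.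
by apply: tangent_eq0 => //; move/eqP: r3; rewrite z1 z3 !mulr0 !addr0 sqrf_eq0 => /eqP.
Qed.

Lemma gP_ge0 : 0 <= g x a a.
Proof.
have [->|/gP_gt0/ltW//] := eqVneq a 0.
by rewrite gE /eta1 /eta2 /eta3 /sigma_form /= !dot0r; lra.
Qed.

End Horizontal.

Lemma gP_riemannian : riemannian_metric P g.
Proof.
split.
- by move=> x _ a b _ _; exact: gP_sym.
- by move=> x _ k a b c _ _ _; exact: gP_linear.
- by move=> x Px a ta; exact: gP_gt0.
- by move=> X Y [sX _] [sY _]; exact: smooth_gP.
Qed.

Lemma vector_field_TP : vf T.
Proof.
have s1 := smooth_comp1 (@smooth_id _ E).
split=> [|x Px].
  apply: smooth_pair; last exact: smooth_cst.
  by apply: smoothZ; [exact: smooth_cst|exact: smooth_xi1].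
apply/tangent_PmP => //=; split; last by rewrite dot0r scale0r.
by rewrite dotZr dotC dot_xi1_self mulr0.
Qed.

Lemma derive_TP x v : 'D_v T x = T v.
Proof.
have d1 := smooth_differentiable x (smooth_comp1 (@smooth_id _ E)).
have dxi := smooth_differentiable x (smooth_xi1 (smooth_comp1 (@smooth_id _ E))).
rewrite derive_pair//; last first.
  by apply: (differentiable_scale (k := fun=> Num.sqrt (A * C) / 2)).
rewrite derive_cst (derive_scale (k := fun=> Num.sqrt (A * C) / 2))// derive_cst scale0r add0r.
by rewrite derive_xi1// derive_comp1// derive_id.
Qed.

(** As [T] is linear, adding [TP_base] to [TP_arg] gives the Lie derivatives along [T]: eta_2 goes
    to 2 lam eta_3, eta_3 to - 2 lam eta_2, while eta_1 and sigma go to 0. *)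
Lemma TP_base x a :
  [/\ eta1 (T x) a = - lam * dot x.1 a.1, eta2 (T x) a = lam * eta3 x a,
      eta3 (T x) a = - lam * eta2 x a & sg (T x) a = 0].
Proof.
rewrite /eta1 /eta2 /eta3 /sigma_form /= /u1 -/lam.
rewrite [xi1 (_ *: _)]linearZ [xi2 (_ *: _)]linearZ [xi3 (_ *: _)]linearZ/=.
rewrite xi11 xi21 xi31 !dotZl !dotNl.
by rewrite linear0 dot0l mulr0; split; ring.
Qed.

Lemma TP_arg x v :
  [/\ eta1 x (T v) = lam * dot x.1 v.1, eta2 x (T v) = lam * eta3 x v,
      eta3 x (T v) = - lam * eta2 x v & sg x (T v) = 0].
Proof.
have xi1v (u : 'M[R]_(m, 4)) : dot u (xi1 v.1) = - dot (xi1 u) v.1 by rewrite dot_xi1l opprK.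
rewrite /eta1 /eta2 /eta3 /sigma_form /= /u1 -/lam !dotZr dot0r mulr0 !xi1v xi11 xi12 xi13 !dotNl.
by split; ring.
Qed.

Lemma TP_self x : P x -> [/\ eta1 x (T x) = lam, eta2 x (T x) = 0, eta3 x (T x) = 0 & sg x (T x) = 0].
Proof.
move=> Px; have [-> -> -> ->] := TP_arg x x.
by rewrite (Pm_dot1 Px) /eta2 /eta3 dot_xi2_self dot_xi3_self !mulr0 mulr1.
Qed.

Lemma gP_TP x v : P x -> g x (T x) v = eta1 x v / lam + p * sg x v.
Proof.
move=> Px; rewrite gE; have [-> -> -> ->] := TP_self Px.
by rewrite dotZl -/lam -/(eta1 x v); field.
Qed.

Lemma gP_TP_unit x : P x -> g x (T x) (T x) = 1.
Proof.
move=> Px; rewrite gP_TP//; have [-> _ _ ->] := TP_self Px.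
by rewrite divff// mulr0 addr0.
Qed.

Lemma eta1_skew a b : eta1 a b = - eta1 b a.
Proof. by rewrite /eta1 dot_xi1l dotC. Qed.

Lemma eta2_skew a b : eta2 a b = - eta2 b a.
Proof. by rewrite /eta2 dot_xi2l dotC. Qed.

Lemma eta3_skew a b : eta3 a b = - eta3 b a.
Proof. by rewrite /eta3 dot_xi3l dotC. Qed.

(** Half of d sigma on two tangent vectors, which vanishes because the circle factor is
    one-dimensional. *)
Lemma sigma_form_tangent x a b : P x -> tangent P x a -> tangent P x b -> sg a b = 0.
Proof.
move=> Px ta tb; rewrite /sigma_form.
have [[_ ->] [_ ->]] := ((tangent_PmP _ Px).1 ta, (tangent_PmP _ Px).1 tb).
by rewrite linearZ/= xi11 dotZl dotZr dotNl (dotC x.2) dot_xi1_self !(mulr0, oppr0).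
Qed.

Lemma eta2B x a b : eta2 x (a - b) = eta2 x a - eta2 x b.
Proof. exact: dotBr. Qed.

Lemma eta3B x a b : eta3 x (a - b) = eta3 x a - eta3 x b.
Proof. exact: dotBr. Qed.

Lemma sigma_formB x a b : sg x (a - b) = sg x a - sg x b.
Proof. by rewrite -mulrBr -dotBr. Qed.

(** The pairing of nabla_a T with b. The two symmetric brackets are half of L_T g, and the last,
    skew term is half of d(T^flat). *)
Definition omega x a b : R :=
  lam * kap * (eta2 x a * eta3 x b + eta3 x a * eta2 x b)
  - q * (eta2 x a * sg x b + sg x a * eta2 x b) + lam^-1 * eta1 a b.

Lemma christoffel_TP x a b : P x -> tangent P x a -> tangent P x b ->
  dgP A C D p q a x (T x) b + dgP A C D p q (T x) x a b - dgP A C D p q b x a (T x)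
    + 2 * g x (T a) b = 2 * omega x a b.
Proof.
move=> Px ta tb; have [[a1 _] [b1 _]] := ((tangent_PmP _ Px).1 ta, (tangent_PmP _ Px).1 tb).
rewrite gE /dgP /omega.
have -> : dot (T a).1 b.1 = lam * eta1 a b by rewrite dotZl.
have [-> -> -> ->] := TP_self Px.
have [-> -> -> ->] := TP_base x a; have [-> -> -> ->] := TP_base x b.
have [-> -> -> ->] := TP_arg x a.
have [-> -> -> ->] := TP_arg a x; have [-> -> -> ->] := TP_arg b x.
rewrite (sigma_form_tangent Px ta tb) (sigma_form_tangent Px tb ta) (eta1_skew b a).
rewrite (eta2_skew a x) (eta2_skew b x) (eta3_skew a x) (eta3_skew b x).
rewrite (dotC a.1) (dotC b.1) a1 b1; generalize_forms.
by field.
Qed.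

(** On horizontal [b], [eta1 a b] is the Euclidean product of [b] with [xi1] of the horizontal part
    of [a]; hence this direction for the horizontal component. *)
Definition test_vector x a (k c2 c3 : R) : E :=
  (k *: xi1 (horizontal x a) + c2 *: xi2 x.1 + c3 *: xi3 x.1, 0).

Lemma test_vectorP x a (k c2 c3 : R) : P x -> tangent P x a ->
  let z := test_vector x a k c2 c3 in
  [/\ tangent P x z, [/\ eta1 x z = 0, eta2 x z = c2, eta3 x z = c3 & sg x z = 0],
    dot z.1 z.1 = k ^+ 2 * dot (horizontal x a) (horizontal x a) + c2 ^+ 2 + c3 ^+ 2
    & eta1 a z = k * dot (horizontal x a) (horizontal x a) + c2 * eta3 x a - c3 * eta2 x a].
Proof.
move=> Px ta z.
have [h0 h1 h2 h3] := horizontal_orthogonal Px ta; have dh := dot_horizontal Px ta.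
rewrite {}/z /test_vector; move: (horizontal x a) h0 h1 h2 h3 dh => h h0 h1 h2 h3 dh.
have [f11 f22 f33 [f12 f13 f23]] := dot_xi_frame Px.
have hh0 : dot x.1 (xi1 h) = 0 by rewrite -[LHS]opprK -dot_xi1l h1 oppr0.
have hh1 : dot (xi1 x.1) (xi1 h) = 0 by rewrite dot_xi1l xi11 dotNr opprK h0.
have hh2 : dot (xi2 x.1) (xi1 h) = 0 by rewrite -[LHS]opprK -dot_xi1l xi12 dotNl h3 !oppr0.
have hh3 : dot (xi3 x.1) (xi1 h) = 0 by rewrite -[LHS]opprK -dot_xi1l xi13 h2 oppr0.
split.
- apply/tangent_PmP => //=; rewrite dot0r scale0r; split=> //.
  by rewrite !dotDr !dotZr hh0 !(dotC x.1) dot_xi2_self dot_xi3_self; ring.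
- rewrite /eta1 /eta2 /eta3 /sigma_form /= dot0r mulr0 !dotDr !dotZr hh1 hh2 hh3.
  by rewrite f12 f13 f22 f33 (dotC (xi3 _)) f23; split; ring.
- rewrite /= !dotDl !dotDr !dotZl !dotZr !(dotC (xi1 h) (_ x.1)) hh2 hh3.
  by rewrite f22 f33 (dotC (xi3 _)) f23 dot_xi1l xi11 dotNr; ring.
- have xi1L (u v w : 'M[R]_(m, 4)) :
      xi1 (k *: u + c2 *: v + c3 *: w) = k *: xi1 u + c2 *: xi1 v + c3 *: xi1 w.
    by rewrite !linearD !linearZ.
  rewrite eta1_skew /eta1 /= xi1L xi11 xi12 xi13 !dotDl !dotZl !dotNl (dotC h) dh.
  by rewrite -/(eta3 x a) -/(eta2 x a); ring.
Qed.

Local Opaque gP dgP TP.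

Section Connection.
Variable nabla : (E -> E) -> (E -> E) -> E -> E.
Hypothesis nablaP : levi_civita P g nabla.

Let smooth_bracket X Y : vf X -> vf Y -> smooth (lie_bracket X Y).
Proof. by move=> [sX _] [sY _]; exact: smooth_lie_bracket. Qed.

Let g_linear := @gP_linear R m A C D p q hC hAC hD.
Let g_sym := @gP_sym R m A C D p q hC hAC hD.
Let vT := vector_field_TP.

Lemma gP_nabla_TP X Z x : vf X -> vf Z -> P x -> g x (nabla X T x) (Z x) = omega x (X x) (Z x).
Proof.
move=> vX vZ Px.
have tX := vX.2 x Px; have tZ := vZ.2 x Px; have tT := vT.2 x Px.
have two0 : 2 != 0 :> R by rewrite pnatr_eq0.
apply: (mulfI two0); rewrite (christoffel g_sym g_linear nablaP (derive_gP p q hC hAC hD) vX vT vZ Px).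
by rewrite derive_TP christoffel_TP.
Qed.

(** [omega x (T x)] reduces to minus the product with the position vector, which kills tangent
    vectors. *)
Lemma nabla_TP_TP x : P x -> nabla T T x = 0.
Proof.
move=> Px; have vN := vector_field_nabla nablaP vT vT.
apply: (vector_field_eq0 gP_riemannian vN Px) => Z vZ.
have [z1 _] := (tangent_PmP _ Px).1 (vZ.2 x Px).
rewrite gP_nabla_TP// /omega; have [_ -> -> ->] := TP_self Px.
have [-> _ _ _] := TP_base x (Z x).
by rewrite z1; ring.
Qed.

Lemma bracket_TP X x : lie_bracket T X x = 'D_(T x) X x - T (X x).
Proof. by rewrite /lie_bracket derive_TP. Qed.

(** The skew part of [omega] cancels between the two bracket terms; what remains with the derivative
    along [T] is minus L_T applied to the symmetric part, that is, to 2 lam kap eta_2 eta_3 - 2 q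
    eta_2 sigma. *)
Lemma gP_curvature_TP X x : vf X -> P x ->
  g x (curvature nabla X T T x) (X x) = g x (nabla X T x) (nabla X T x)
    - 4 * lam ^+ 2 * kap * (eta3 x (X x) ^+ 2 - eta2 x (X x) ^+ 2)
    + 4 * q * lam * (eta3 x (X x) * sg x (X x)).
Proof.
move=> vX Px; have vW := vector_field_nabla nablaP vX vT.
have vB := vector_field_bracket tangent_Pm_linear smooth_bracket nablaP vT vX.
rewrite (geodesic_field_curvature g_sym g_linear gP_riemannian tangent_Pm_linear smooth_bracket
  nablaP vT nabla_TP_TP vX Px).
pose k y := 2 * lam * kap * (eta2 y (X y) * eta3 y (X y)) + - (2 * q) * (eta2 y (X y) * sg y (X y)).
have [[e2 e3] s] := (der_eta2 vX.1 x (T x), der_eta3 vX.1 x (T x), der_sigma_form D vX.1 x (T x)).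
have [dk Dk] := derD (derZ (2 * lam * kap) (derM e2 e3)) (derZ (- (2 * q)) (derM e2 s)).
(* [k] agrees with g(nabla_X T, X) only on the manifold, which suffices because [T] is tangent. *)
rewrite (derive_tangent_eq (g := k) _ _ _ (vT.2 x Px)); last 3 first.
- exact: (smooth_differentiable x (smooth_gP p q hC hAC hD vW.1 vX.1)).
- exact: dk.
- move=> y Py; rewrite gP_nabla_TP// /omega /k.
  by rewrite /eta1 dot_xi1_self; generalize_forms; ring.
have [t1 t2 t3 t4] := TP_base x (X x); have [u1 u2 u3 u4] := TP_arg x (X x).
have b2 : eta2 x (lie_bracket T X x) = eta2 x ('D_(T x) X x) - lam * eta3 x (X x).
  by rewrite bracket_TP eta2B u2.
have b3 : eta3 x (lie_bracket T X x) = eta3 x ('D_(T x) X x) + lam * eta2 x (X x).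
  by rewrite bracket_TP eta3B u3 mulNr opprK.
have b4 : sg x (lie_bracket T X x) = sg x ('D_(T x) X x) by rewrite bracket_TP sigma_formB u4 subr0.
rewrite /k Dk (gP_nabla_TP vX vB Px) (gP_nabla_TP vB vX Px) /omega b2 b3 b4 t2 t3 t4.
by rewrite (eta1_skew (lie_bracket T X x)); generalize_forms; ring.
Qed.

(* |W|^2 >= 2 g(W, z) - g(z, z), where z is g-dual to [omega x (X x)] up to the
   coupling of u_3 with the circle factor, which the estimate can afford to ignore. *)
Lemma nabla_TP_norm_ge X x : vf X -> P x ->
  dot (horizontal x (X x)) (horizontal x (X x))
    + A ^+ 2 / 4 * (4 * lam / A ^+ 2 * eta3 x (X x) - q * sg x (X x)) ^+ 2
    + lam ^+ 2 * (4 * lam / A ^+ 2 - 2 / lam) ^+ 2 * eta2 x (X x) ^+ 2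
  <= g x (nabla X T x) (nabla X T x).
Proof.
move=> vX Px; set h := horizontal x (X x).
set e2 := eta2 x (X x); set e3 := eta3 x (X x); set s := sg x (X x).
have tX := vX.2 x Px.
(* The coefficients of [omega x (X x)] on xi_2 and xi_3 are 4 lam / A^2 e3 - q s and (4 lam / A^2 -
   2 / lam) e2; they are divided by the squared g-lengths 4 / A^2 and 1 / lam^2. Likewise [lam] is 1
   / lam divided by 1 / lam^2. *)
pose c2 := A ^+ 2 / 4 * (4 * lam / A ^+ 2 * e3 - q * s).
pose c3 := lam ^+ 2 * (4 * lam / A ^+ 2 - 2 / lam) * e2.
have [tz [z1 z2 z3 zs] zz Xz] := test_vectorP lam c2 c3 Px tX.
move: (test_vector _ _ _ _ _) tz z1 z2 z3 zs zz Xz => z tz z1 z2 z3 zs zz Xz.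
rewrite -/h -/e2 -/e3 in zz Xz.
have [Z vZ Zx] := vector_field_extension Px tz.
have vW := vector_field_nabla nablaP vX vT.
have := gP_ge0 Px (tangent_Pm_linear (-1) Px tz (vW.2 x Px)).
have -> : g x (-1 *: z + nabla X T x) (-1 *: z + nabla X T x) =
    g x z z - 2 * g x (nabla X T x) z + g x (nabla X T x) (nabla X T x).
  rewrite g_linear (g_sym x z) (g_sym x (nabla X T x)) !g_linear (g_sym x z (nabla X T x)).
  ring.
have -> : g x (nabla X T x) z = omega x (X x) z by rewrite -Zx gP_nabla_TP.
rewrite gE /omega z1 z2 z3 zs zz Xz -/s -/e2 -/e3 => W0.
rewrite -subr_ge0; apply: le_trans W0 _; rewrite le_eqVlt; apply/orP; left; apply/eqP.
rewrite /c2 /c3 /xi2_defect; clearbody e2 e3 s; generalize_forms.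
by field; rewrite A0 lam0.
Qed.

Lemma gP_curvature_TP_gt0 X x : q != 0 -> vf X -> P x -> X x != 0 -> g x (X x) (T x) = 0 ->
  0 < g x (curvature nabla X T T x) (X x).
Proof.
move=> hq vX Px Xn0 XT; have tX := vX.2 x Px; have A_gt0 := A_gt0 hC hAC.
have := nabla_TP_norm_ge vX Px; have := dot_ge0 (horizontal x (X x)).
rewrite gP_curvature_TP//.
move: XT; rewrite g_sym gP_TP//; have := tangent_eq0 Px tX.
set h := dot (horizontal _ _) _; set e1 := eta1 _ _; set e2 := eta2 _ _.
set e3 := eta3 _ _; set s := sg _ _; set W := g x _ _.
clearbody h e1 e2 e3 s W => X0 e1s h_ge0 W_ge.
(* With 4 lam^2 / A^2 = C / A, the coefficient of e2^2 is (C/A - 2)^2 + 4 (C/A - 1) = (C/A)^2.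
   Adding 4 q lam e3 s to the cross term - 2 q lam e3 s flips the sign inside the square. *)
set S := h + A ^+ 2 / 4 * (4 * lam / A ^+ 2 * e3 + q * s) ^+ 2
  + 4 * ((A - C) / A) * e3 ^+ 2 + (4 * lam ^+ 2 / A ^+ 2) ^+ 2 * e2 ^+ 2.
suff S_gt0 : 0 < S.
  apply: lt_le_trans S_gt0 _; rewrite -subr_ge0; rewrite -subr_ge0 in W_ge.
  apply: le_trans W_ge _; rewrite le_eqVlt; apply/orP; left; apply/eqP.
  rewrite /S; have -> : (A - C) / A = 1 - 4 * lam ^+ 2 / A ^+ 2 by rewrite lam_sqr//; field.
  by rewrite /xi2_defect; field; rewrite A0 lam0.
have c3_gt0 : 0 < 4 * ((A - C) / A) by rewrite mulr_gt0// divr_gt0// subr_gt0.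
have c1_gt0 : 0 < A ^+ 2 / 4 by rewrite divr_gt0// exprn_gt0.
have c2_gt0 : 0 < (4 * lam ^+ 2 / A ^+ 2) ^+ 2.
  by rewrite exprn_gt0// divr_gt0 ?exprn_gt0// mulr_gt0// exprn_gt0// lam_gt0.
have S1 : 0 <= A ^+ 2 / 4 * (4 * lam / A ^+ 2 * e3 + q * s) ^+ 2 by rewrite mulr_ge0 ?sqr_ge0// ltW.
have S2 : 0 <= 4 * ((A - C) / A) * e3 ^+ 2 by rewrite mulr_ge0 ?sqr_ge0// ltW.
have S3 : 0 <= (4 * lam ^+ 2 / A ^+ 2) ^+ 2 * e2 ^+ 2 by rewrite mulr_ge0 ?sqr_ge0// ltW.
rewrite lt_neqAle; apply/andP; split; last by rewrite /S; do 3?[apply: addr_ge0].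
apply/negP => /eqP S0; move/eqP: Xn0; apply.
have h0 : h = 0 by rewrite /S in S0; lra.
have /eqP e20 : (4 * lam ^+ 2 / A ^+ 2) ^+ 2 * e2 ^+ 2 = 0 by rewrite /S in S0; lra.
have /eqP e30 : 4 * ((A - C) / A) * e3 ^+ 2 = 0 by rewrite /S in S0; lra.
have /eqP s0 : A ^+ 2 / 4 * (4 * lam / A ^+ 2 * e3 + q * s) ^+ 2 = 0 by rewrite /S in S0; lra.
(* A > C forces e3 = 0, then q <> 0 forces s = 0, and then orthogonality to [T] forces e1 = 0. *)
move: e20 e30 s0; rewrite mulf_eq0 (gt_eqF c2_gt0) sqrf_eq0 => /eqP e20.
rewrite mulf_eq0 (gt_eqF c3_gt0) sqrf_eq0 => /eqP e30.
rewrite mulf_eq0 (gt_eqF c1_gt0) sqrf_eq0 e30 mulr0 add0r mulf_eq0 (negPf hq) => /eqP s0.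
apply: X0 => //; move/eqP: e1s; rewrite s0 mulr0 addr0 mulf_eq0 invr_eq0 (negPf lam0) orbF.
by move/eqP.
Qed.

End Connection.

Lemma gP_totally_geodesic : totally_geodesic P g T.
Proof.
move=> nabla nablaP X Y vX vY lX lY x Px.
exact: (geodesic_field_totally_geodesic (@gP_linear R m A C D p q hC hAC hD) gP_riemannian
  (@tangent_Pm_linear R m) nablaP vector_field_TP gP_TP_unit (nabla_TP_TP nablaP) vX vY lX lY Px).
Qed.

Lemma gP_Kmix_positive : q != 0 -> Kmix_positive P g T.
Proof.
move=> hq nabla nablaP x X Px vX Xn0 XT; rewrite /sectional_curvature XT expr0n subr0 gP_TP_unit// mulr1.
by apply: divr_gt0; [exact: gP_curvature_TP_gt0|apply: gP_gt0 => //; exact: vX.2].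
Qed.

End Geometry.

(** * The leaves *)

Section Trigonometry.
Context {R : realType}.

Lemma cos_sin_inj (a b : R) : 0 <= a < 2 * pi -> 0 <= b < 2 * pi ->
  cos a = cos b -> sin a = sin b -> a = b.
Proof.
wlog ab : a b / a <= b => [H|] aI bI cab sab.
  by have [/H|/ltW/H] := leP a b; [exact|move=> /(_ bI aI)->].
apply/eqP; rewrite eq_le ab/= leNgt; apply/negP => lt_ab.
(* Half the difference lies strictly between 0 and pi, where sine is positive, while cos (2 d) = 1
   makes it vanish. *)
pose d := (b - a) / 2.
have dI : 0 < d < pi.
  move: aI bI lt_ab => /andP[a0 a2] /andP[b0 b2] lt_ab.
  by rewrite /d; apply/andP; split; lra.
have d2 : d *+ 2 = b - a by rewrite mulr2n /d -splitr.
have : cos (b - a) = 1 by rewrite cosB -cab -sab -!expr2 cos2Dsin2.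
rewrite -d2 cos_mulr2n cos2sin2 => s0.
have := sin_gt0_pi dI; have /eqP : sin d ^+ 2 = 0 by lra.
by rewrite sqrf_eq0 => /eqP ->; rewrite ltxx.
Qed.

End Trigonometry.

Section Flow.
Context {R : realType} {m : nat}.
Variables A C D p q : R.
Hypotheses (hC : 0 < C) (hAC : C < A) (hD : 0 < D) (hpq : p ^+ 2 + q ^+ 2 < 1).
Notation E := (@ambient R m).
Notation P := (@Pm R m).
Notation g := (@gP R m A C D p q).
Notation T := (@TP R m A C).
Implicit Types (x y v a b : E) (s t : R).
Local Notation lam := (leaf_speed A C).

Let lam_gt0 : 0 < lam := lam_gt0 hC hAC.

(** Right multiplication of the sphere factor by exp(i lam t). *)
Definition flow t y : E := (circular lam y.1 (xi1 y.1) t, y.2).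

Lemma flow0 y : flow 0 y = y.
Proof. by rewrite /flow circular0; case: y. Qed.

Lemma flow_Pm t y : P y -> P (flow t y).
Proof.
move=> Py; split; last by case: Py.
rewrite /qsphere /= /circular dotDl !dotDr !dotZl !dotZr (dotC y.1 (xi1 _)) dot_xi1_self.
by rewrite dot_xi1l xi11 dotNr opprK (Pm_dot1 Py) -[RHS](cos2Dsin2 (lam * t)); ring.
Qed.

Lemma xi1_circular (u : 'M[R]_(m, 4)) t :
  xi1 (circular lam u (xi1 u) t) = circular lam (xi1 u) (- u) t.
Proof. by rewrite /circular linearD !linearZ/= xi11. Qed.

Lemma smooth_flow y : smooth (flow ^~ y).
Proof. by apply: smooth_pair; [exact: smooth_circular|exact: smooth_cst]. Qed.

Lemma derive1_flow y t : derive1 (flow ^~ y) t = T (flow t y).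
Proof.
have d1 := smooth_differentiable t (smooth_circular lam y.1 (xi1 y.1)).
rewrite derive1E derive_pair// derive_cst -derive1E derive1_circular.
by rewrite /TP /u1 /= xi1_circular.
Qed.

Lemma is_derive_flow y t : is_derive t (1 : R) (flow ^~ y) (T (flow t y)).
Proof.
apply: DeriveDef; last by rewrite -derive1E derive1_flow.
exact/diff_derivable/smooth_differentiable/smooth_flow.
Qed.

(** Uniqueness without a general theorem on differential equations: [T] is linear and skew, so the
    Euclidean norm of the difference of two solutions is constant. *)
Lemma integral_curve_flow (c : R -> E) x t :
  (forall s, is_derive s (1 : R) c (T (c s))) -> c 0 = x -> c t = flow t x.
Proof.
move=> dc c0.
have dcs s : differentiable c s by apply/derivable1_diffP; have [] := dc s.
have dfs s : differentiable (flow ^~ x) s by exact/smooth_differentiable/smooth_flow.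
pose d s : E := c s - flow s x.
have dd s : differentiable d s by apply: differentiableB.
have Dd s : 'D_1 d s = T (d s).
  rewrite deriveB; [|exact: diff_derivable..].
  have [_ ->] := dc s; have [_ ->] := is_derive_flow x s.
  by rewrite /d /TP /u1 /= [xi1 (_ - _)]linearB/= scalerBr; congr (_, _); rewrite /= subr0.
pose F s := dot (d s).1 (d s).1 + dot (d s).2 (d s).2.
have dF s : is_derive s (1 : R) F 0.
  have d1 := differentiable_comp1 (dd s); have d2 := differentiable_comp2 (dd s).
  have dF1 := differentiable_dot d1 d1; have dF2 := differentiable_dot d2 d2.
  apply: DeriveDef; first by apply/diff_derivable/differentiableD.
  rewrite deriveD; [|exact: diff_derivable..].
  rewrite !derive_dot// !derive_comp1// !derive_comp2// Dd /= dot0l dot0r.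
  by rewrite /u1 dotZl dotZr [dot (d s).1 _]dotC dot_xi1_self; ring.
have : F t = 0.
  rewrite (is_derive_0_is_cst t 0 dF) /F /d c0 flow0 subrr /= dot0l dot0l; ring.
move=> /eqP; rewrite paddr_eq0 ?dot_ge0// => /andP[/eqP/dot_eq0 h1 /eqP/dot_eq0 h2].
apply/eqP; rewrite -subr_eq0 -/(d t); apply/eqP.
by case: (d t) h1 h2 => /= ? ? -> ->.
Qed.

Lemma TP_neq0 y : P y -> T y != 0.
Proof.
move=> Py; apply/eqP => Ty0; have := gP_TP_unit p q hC hAC hD Py.
rewrite Ty0 (form0l (gP_linear p q hC hAC hD)) => /eqP.
by rewrite eq_sym oner_eq0.
Qed.

Lemma gP_generates_foliation : generates_foliation P T.
Proof. by split; [exact: vector_field_TP|exact: TP_neq0]. Qed.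

Lemma leaf_flow x : P x -> leaf P T x = range (flow ^~ x).
Proof.
move=> Px; apply/seteqP; split=> y.
  by move=> [c [_ dc c0 [t <-]]]; exists t => //; rewrite -(integral_curve_flow t dc c0).
move=> [t _ <-]; exists (flow ^~ x); split=> [s|s||].
- exact: flow_Pm.
- exact: is_derive_flow.
- exact: flow0.
- by exists t.
Qed.

(** [T] has g-length 1, so the length is the period 2 pi / lam. Injectivity on a period follows by
    pairing with the orthonormal vectors [x.1] and [xi1 x.1], which reads off cosine and sine. *)
Lemma gP_leaf_closed_circle x : P x ->
  closed_circle_of_length g (leaf P T x) (4 * pi / Num.sqrt (A * C)).
Proof.
move=> Px; have lam0 := lt0r_neq0 lam_gt0.
have -> : 4 * pi / Num.sqrt (A * C) = 2 * pi / lam.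
  rewrite /leaf_speed invf_div; field.
  by rewrite gt_eqF// sqrtr_gt0 mulr_gt0// (A_gt0 hC hAC).
pose b := 2 * pi / lam; have b_gt0 : 0 < b by rewrite divr_gt0// mulr_gt0// pi_gt0.
have lamb : lam * b = pi *+ 2 by rewrite /b mulrCA divff// mulr1 mulr_natl.
exists (flow ^~ x), b; split=> //.
- split; first exact: smooth_flow.
  by move=> t; rewrite derive1_flow; exact/TP_neq0/flow_Pm.
- split=> [t|s t sI tI st].
    by rewrite /flow /circular mulrDr lamb cosD2pi sinD2pi.
  have lamI r : 0 <= r < b -> 0 <= lam * r < 2 * pi.
    move=> /andP[r0 rb]; rewrite mulr_ge0 ?(ltW lam_gt0)//=.
    by rewrite mulr_natl -lamb ltr_pM2l.
  have x1 := Pm_dot1 Px.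
  have xx : dot (xi1 x.1) (xi1 x.1) = 1 by rewrite dot_xi1l xi11 dotNr opprK x1.
  have st1 : circular lam x.1 (xi1 x.1) s = circular lam x.1 (xi1 x.1) t by case: st.
  apply: (mulfI lam0); apply: cos_sin_inj; [exact: lamI|exact: lamI|..].
    have := congr1 (dot x.1) st1.
    by rewrite !dotDr !dotZr x1 (dotC x.1) dot_xi1_self !mulr0 !addr0 !mulr1.
  have := congr1 (dot (xi1 x.1)) st1.
  by rewrite !dotDr !dotZr xx dot_xi1_self !mulr0 !add0r !mulr1.
- exact: leaf_flow.
- rewrite /curve_length (eq_integral (cst 1%:E)) => [|t _]; last first.
    by rewrite derive1_flow gP_TP_unit ?sqrtr1//; exact: flow_Pm.
  rewrite integral_cst//= lebesgue_measure_itv/= lte_fin b_gt0 mul1e.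
  by rewrite sube0.
Qed.

End Flow.

(** * Failure of bundle-likeness *)

Section BundleLike.
Context {R : realType}.

(** Only a segment is considered because the local submersion is controlled only while the flow
    stays in its domain. The mean value theorem is applied to each coordinate. *)
Lemma derive0_segment_cst d (h : R -> 'rV[R]_d) (t : R) : 0 <= t ->
  (forall s, 0 <= s <= t -> differentiable h s /\ 'D_1 h s = 0) -> h t = h 0.
Proof.
move=> t0 dh; apply/rowP => j.
pose k s := dot (h s) (delta_mx 0 j).
have dk s : 0 <= s <= t -> is_derive s (1 : R) k 0.
  move=> /dh [dhs Dhs]; apply: DeriveDef.
    by apply/diff_derivable/differentiable_dot => //; exact: differentiable_cst.
  by rewrite derive_dot// Dhs derive_cst dot0l dot0r addr0.
suff : k t = k 0 by rewrite /k !dot_delta.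
have kin s : s \in `]0, t[ -> is_derive s (1 : R) k (cst 0 s).
  by rewrite in_itv/= => /andP[/ltW s0 /ltW st]; apply: dk; rewrite s0.
have kc : {within `[0, t], continuous k}.
  by apply: derivable_within_continuous => s; rewrite in_itv/= => /dk [].
by have [s _ /eqP] := MVT_segment t0 kin kc; rewrite mul0r subr_eq0 => /eqP.
Qed.

Variables (m : nat) (A C D p q : R).
Hypotheses (hC : 0 < C) (hAC : C < A) (hD : 0 < D).
Notation E := (@ambient R m).
Notation P := (@Pm R m).
Notation g := (@gP R m A C D p q).
Notation T := (@TP R m A C).
Implicit Types (x y v a b : E) (s t : R).
Local Notation lam := (leaf_speed A C).
Local Notation kap := (xi2_defect A C).
Local Notation flow := (flow A C).

Let lam_gt0 : 0 < lam := lam_gt0 hC hAC.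

(** The curve x exp(j s) with initial velocity xi_2; it crosses the leaves and lets the flow be
    differentiated transversally. *)
Definition fiber_curve x s : E := (circular 1 x.1 (xi2 x.1) s, x.2).

Lemma fiber_curve0 x : fiber_curve x 0 = x.
Proof. by rewrite /fiber_curve circular0; case: x. Qed.

Lemma fiber_curve_Pm x s : P x -> P (fiber_curve x s).
Proof.
move=> Px; split; last by case: Px.
rewrite /qsphere /= /circular dotDl !dotDr !dotZl !dotZr (dotC x.1 (xi2 _)) dot_xi2_self.
by rewrite dot_xi2l xi22 dotNr opprK (Pm_dot1 Px) -[RHS](cos2Dsin2 (1 * s)); ring.
Qed.

(* The image of [(xi2 x.1, 0)] under the differential of the flow. *)
Definition transported x t : E := (circular lam (xi2 x.1) (xi1 (xi2 x.1)) t, 0).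

Lemma derive_flow_fiber x t :
  is_derive (0 : R) (1 : R) (fun s => flow t (fiber_curve x s)) (transported x t).
Proof.
have dc : differentiable (circular 1 x.1 (xi2 x.1)) 0 by exact/smooth_differentiable/smooth_circular.
have dL (k : R) (L : {linear 'M[R]_(m, 4) -> 'M[R]_(m, 4)}) :
    is_derive (0 : R) (1 : R) (fun s => k *: L (circular 1 x.1 (xi2 x.1) s)) (k *: L (xi2 x.1)).
  have cL := @mx_linear_continuous R m 4 _ L.
  have dLc := differentiable_linear cL dc.
  apply: DeriveDef; first by apply/diff_derivable; exact: (differentiable_scale (k := fun=> k)).
  rewrite (derive_scale (k := fun=> k))// derive_cst scale0r add0r derive_linear//.
  by rewrite -derive1E derive1_circular circular0 scale1r.
have [dv Dv] := is_deriveD (dL (cos (lam * t)) idfun) (dL (sin (lam * t)) (@xi1 R m)).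
have df : differentiable (fun s =>
    circular lam (circular 1 x.1 (xi2 x.1) s) (xi1 (circular 1 x.1 (xi2 x.1) s)) t) 0.
  exact/derivable1_diffP.
apply: DeriveDef.
  by apply/diff_derivable/differentiable_pair => //; exact: differentiable_cst.
by rewrite (derive_pair (g := fun=> x.2))// derive_cst; congr (_, _).
Qed.

Lemma differentiable_flow_fiber x (z : R * R) :
  differentiable (fun z : R * R => flow z.1 (fiber_curve x z.2)) z.
Proof.
have d1 : differentiable (fst : R * R -> R) z by exact: (differentiable_fst (f := id)).
have d2 : differentiable (snd : R * R -> R) z by exact: (differentiable_snd (f := id)).
have dc := differentiable_comp d1 (differentiable_cosM lam z.1).
have ds := differentiable_comp d1 (differentiable_sinM lam z.1).
have dg : differentiable (fun z : R * R => circular 1 x.1 (xi2 x.1) z.2) z.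
  by apply: (differentiable_comp d2); exact/smooth_differentiable/smooth_circular.
have dxg := @differentiable_linear _ _ _ _ (@xi1 R m) (@mx_linear_continuous _ _ _ _ _) _ _ dg.
apply: differentiable_pair; last exact: differentiable_cst.
exact: (differentiableD (differentiable_scale dc dg) (differentiable_scale ds dxg)).
Qed.


(** One [e] must serve both parameters: invariance of the submersion under the flow is needed for a
    whole interval of [s] before it can be differentiated in [s]. *)
Lemma near_flow_fiber x (U : set E) : open U -> U x ->
  exists2 e : R, 0 < e & forall t s, `|t| < e -> `|s| < e -> U (flow t (fiber_curve x s)).
Proof.
move=> oU Ux.
have cf := differentiable_continuous (differentiable_flow_fiber x (0 : R, 0 : R)).
have nU : nbhs (flow (0 : R) (fiber_curve x (0 : R))) U.
  by rewrite /= fiber_curve0 flow0; exact: (open_nbhs_nbhs (conj oU Ux)).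
have /nbhs_ballP[e /= e0 eU] := cf U nU.
exists e => // t s te se; apply: (eU (t, s)).
by split; rewrite -ball_normE /ball_ /= sub0r normrN.
Qed.

(** With c, s the cosine and sine of lam t, the transported vector is c xi_2 - s xi_3, both taken at
    x, whereas xi_2 at the moved point is c xi_2 + s xi_3; their product is cos (2 lam t). *)
Lemma transported_forms x t : P x ->
  let y := flow t x in let a := transported x t in
  [/\ dot y.1 a.1 = 0, eta1 y a = 0, dot a.1 a.1 = 1
    & eta2 y a = cos (lam * t) ^+ 2 - sin (lam * t) ^+ 2].
Proof.
move=> Px y a; have [f11 f22 f33 [f12 f13 f23]] := dot_xi_frame Px.
have x1 := Pm_dot1 Px; have := cos2Dsin2 (lam * t).
have LC (L : {linear 'M[R]_(m, 4) -> 'M[R]_(m, 4)}) (u v : 'M[R]_(m, 4)) (k l : R) :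
  L (k *: u + l *: v) = k *: L u + l *: L v by rewrite linearD !linearZ.
rewrite {}/y {}/a /eta1 /eta2 /= /circular xi12 (LC (@xi1 R m)) (LC (@xi2 R m)) /= xi11 xi21.
move: (cos _) (sin _) => c s cs1.
rewrite !dotDl !dotDr !dotZl !dotZr !dotNl !dotNr.
rewrite [dot (xi3 _) (xi2 _)]dotC (dotC x.1 (xi2 _)) (dotC x.1 (xi3 _)).
rewrite dot_xi2_self dot_xi3_self f22 f33 f12 f13 f23.
by split; [ring|ring|rewrite -[RHS]cs1; ring|ring].
Qed.

Lemma transported_metric x t : P x ->
  let y := flow t x in let a := transported x t in
  [/\ tangent P y a, forall v, leaf_direction T y v -> g y a v = 0
    & g y a a = lam^-1 ^+ 2 + kap * (cos (lam * t) ^+ 2 - sin (lam * t) ^+ 2) ^+ 2].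
Proof.
move=> Px y a; have [ya a1 aa a2] := transported_forms t Px.
have Py : P y := flow_Pm A C t Px.
have sga : sigma_form D y a = 0 by rewrite /sigma_form /= dot0r mulr0.
split.
- by apply/tangent_PmP => //; rewrite /= dot0r scale0r.
- move=> _ [k ->]; rewrite gP_sym// (formZl (gP_linear p q hC hAC hD)) gP_TP//.
  by rewrite a1 sga !(mul0r, mulr0, addr0).
- by rewrite gPE// aa a1 a2 sga; generalize_forms; ring.
Qed.

Lemma kap_neq0 : kap != 0.
Proof.
have A0 := lt0r_neq0 (A_gt0 hC hAC); have C0 := lt0r_neq0 hC.
have -> : kap = 4 * (C - A) / (A ^+ 2 * C).
  by rewrite /xi2_defect exprVn lam_sqr//; field; rewrite A0 C0.
by rewrite !mulf_neq0// ?invr_eq0 ?mulf_neq0 ?expf_neq0// subr_eq0 lt_eqF.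
Qed.

(** A local submersion [f] is invariant under the flow, so it sends the transported vectors to one
    vector over one base point. These vectors are horizontal, so their g-length would be constant in
    time. *)
Lemma gP_not_bundle_like : P !=set0 -> ~ bundle_like P g T.
Proof.
move=> [x Px] /(_ x Px)[U [oU Ux [d [f [B [gB [[[sf _] _ _ _ iso] vert]]]]]]].
have df y : U y -> differentiable f y by have [dfU _] := sf 1%N; exact: dfU.
have [e e0 eU] := near_flow_fiber oU Ux.
(* [e / 2] keeps the flow inside [U]; the other bound keeps lam t in (0, pi/2), where (cos^2 -
   sin^2)^2 < 1. *)
pose t := Num.min (e / 2) (pi / 4 / lam).
have pi0 : 0 < pi :> R by exact: pi_gt0.
have t0 : 0 < t by rewrite lt_min; apply/andP; split; [exact: divr_gt0|by do 2?[apply: divr_gt0 => //]].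
have te : t < e by rewrite gt_min; apply/orP; left; rewrite ltr_pdivrMr//; lra.
have lamt : 0 < lam * t < pi / 2.
  rewrite mulr_gt0//= (@le_lt_trans _ _ (pi / 4))//; last by have := @pi_gt0 R; lra.
  by rewrite mulrC -ler_pdivlMr// ge_min lexx orbT.
have Pflow r s : P (flow r (fiber_curve x s)) by exact/flow_Pm/fiber_curve_Pm.
have f_flow s : `|s| < e -> f (flow t (fiber_curve x s)) = f (fiber_curve x s).
  move=> se; rewrite -[in RHS](flow0 A C (fiber_curve x s)).
  apply: (derive0_segment_cst (h := fun r => f (flow r (fiber_curve x s))) (ltW t0)).
  move=> r /andP[r0 rt].
  have Ur : U (flow r (fiber_curve x s)) by apply: eU => //; rewrite ger0_norm// (le_lt_trans rt).
  have dr : differentiable (flow ^~ (fiber_curve x s)) r by exact/smooth_differentiable/smooth_flow.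
  have dfr := df _ Ur; split; first exact: (differentiable_comp dr dfr).
  rewrite -derive1E -(derive1_comp_curve dfr dr) derive1_flow; apply/(vert _ Ur) => //.
    exact: (vector_field_TP A C).2.
  by exists 1; rewrite scale1r.
have ft : f (flow t x) = f x by have := f_flow 0; rewrite normr0 fiber_curve0; exact.
have Ut r : `|r| < e -> U (flow r x).
  by move=> re; rewrite -[x]fiber_curve0; apply: eU => //; rewrite normr0.
have norm_f r : `|r| < e -> g (flow r x) (transported x r) (transported x r) =
    ('D_(transported x r) f (flow r x) *m gB (f (flow r x)) *m
      ('D_(transported x r) f (flow r x))^T) 0 0.
  move=> re; have [ta la _] := transported_metric r Px.
  apply: (iso _ (Ut _ re)) => //; first exact: flow_Pm.
  move=> k tk Dk; rewrite la//.
  by apply/(vert _ (Ut _ re)) => //; exact: flow_Pm.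
have Df r : `|r| < e ->
    'D_(transported x r) f (flow r x) = 'D_1 (fun s => f (flow r (fiber_curve x s))) 0.
  move=> re; have [dd Dd] := derive_flow_fiber x r.
  have dd' : differentiable (fun s => flow r (fiber_curve x s)) 0 by exact/derivable1_diffP.
  have dfr : differentiable f (flow r (fiber_curve x 0)) by apply: df; apply: eU; rewrite ?normr0.
  by rewrite -derive1E -(derive1_comp_curve dfr dd') derive1E Dd fiber_curve0.
have e_t : `|t| < e by rewrite gtr0_norm.
have e_0 : `|0 : R| < e by rewrite normr0.
have : g (flow t x) (transported x t) (transported x t) =
    g (flow 0 x) (transported x 0) (transported x 0).
  rewrite (norm_f t e_t) (norm_f 0 e_0) (Df t e_t) (Df 0 e_0) flow0 ft.
  suff -> : 'D_1 (fun s => f (flow t (fiber_curve x s))) 0 =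
    'D_1 (fun s => f (flow 0 (fiber_curve x s))) 0 by [].
  (* The two functions of [s] agree only for |s| < e, which is enough for their derivatives at 0. *)
  apply: near_eq_derive; apply/nbhs_ballP; exists e => //= s.
  by rewrite -ball_normE /ball_ /= sub0r normrN => se; rewrite f_flow// flow0.
have [_ _ ->] := transported_metric t Px; have [_ _ ->] := transported_metric 0 Px.
rewrite mulr0 cos0 sin0 => /addrI/(mulfI kap_neq0).
have s_gt0 : 0 < sin (lam * t) by exact: sin_gt0_pihalf.
have c_gt0 : 0 < cos (lam * t).
  by apply: cos_gt0_pihalf; move: lamt => /andP[l0 ->]; rewrite andbT; have := @pi_gt0 R; lra.
have := cos2Dsin2 (lam * t); move: (cos _) (sin _) s_gt0 c_gt0 => c s s_gt0 c_gt0 cs1 cs2.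
have : 0 < c ^+ 2 * s ^+ 2 by rewrite mulr_gt0// exprn_gt0.
suff -> : c ^+ 2 * s ^+ 2 = 0 by rewrite ltxx.
(* This is sin^2 (2 theta) = 1 - cos^2 (2 theta), up to the factor 4; equal lengths would make the
   right side vanish. *)
have -> : c ^+ 2 * s ^+ 2 = ((c ^+ 2 + s ^+ 2) ^+ 2 - (c ^+ 2 - s ^+ 2) ^+ 2) / 4 by field.
by rewrite cs1 cs2; ring.
Qed.

End BundleLike.

Theorem proposition5p1 (R : realType) (m : nat) (A C D p q : R)
    (hm : (1 <= m)%N) (hC : 0 < C) (hAC : C < A) (hD : 0 < D)
    (hp : p != 0) (hq : q != 0) (hpq : p ^+ 2 + q ^+ 2 < 1) :
  let M := @Pm R m in
  let g := @gP R m A C D p q in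
  let T := @TP R m A C in
  riemannian_metric M g /\
  [/\ generates_foliation M T,
      totally_geodesic M g T,
      Kmix_positive M g T,
      forall x, M x ->
        closed_circle_of_length g (leaf M T x) (4 * pi / Num.sqrt (A * C))
    & ~ bundle_like M g T].
Proof.
split; first exact: gP_riemannian.
split.
- exact: (@gP_generates_foliation R m A C D p q).
- exact: gP_totally_geodesic.
- exact: gP_Kmix_positive.
- by move=> x Px; exact: gP_leaf_closed_circle.
- apply: gP_not_bundle_like => //.
  (* A point is required because [bundle_like] holds vacuously on an empty manifold; [hm] provides
     the coordinate in which to put the quaternion 1. *)
  exists (delta_mx (Ordinal hm) 0, delta_mx 0 0); split; rewrite /qsphere /circle_i /=.
    by rewrite dot_delta mxE !eqxx.
  by rewrite !mxE /= !mulr0n !mulr1n expr1n expr0n addr0.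
Qed.
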